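(* Let $F$ be a generalised multi-clause-set and $\varphi_0$ a partial assignment. Then in time polynomial in the size of $F$ (and $\varphi_0$) one can compute a finite sequence of conservative changes with respect to $F$, starting with $\varphi_0$, such that the finally obtained partial assignment $\varphi$ is matching-maximum for $F$, i.e. $\nu(B_{\varphi}(F)) = \nu(B(F))$.
   Context: Every variable $v$ has a finite non-empty domain $D_v$. A literal is a pair $(v,\varepsilon)$ with $\varepsilon\in D_v$ (meaning ''$v\neq\varepsilon$''). A clause is a finite set of literals containing no two distinct literals with the same variable. A (generalised) multi-clause-set $F$ is a map from clauses to $\mathbb{N}_0$ with finite support ($F(C)$ = number of occurrences of $C$); $\mathrm{var}(C)$, $\mathrm{var}(F)$ denote the variables occurring. A partial assignment $\varphi$ is a map from a finite set $\mathrm{var}(\varphi)$ of variables with $\varphi(v)\in D_v$; it satisfies the literal $(v,\varepsilon)$ iff $v\in\mathrm{var}(\varphi)$ and $\varphi(v)\neq\varepsilon$, and satisfies a clause iff it satisfies one of its literals. The bipartite graph $B(F)$ has clause-nodes $(C,i)$ for $C$ with $F(C)>0$, $1\le i\le F(C)$, and variable-nodes $(v,j)$ for $v\in\mathrm{var}(F)$, $1\le j\le |D_v|-1$; $(C,i)$ and $(v,j)$ are adjacent iff $v\in\mathrm{var}(C)$. For a partial assignment $\varphi$, $B_\varphi(F)$ is the subgraph of $B(F)$ with the same vertices keeping exactly those edges $\{(C,i),(v,j)\}$ for which $\varphi$ satisfies the literal of $C$ with variable $v$. $\nu(G)$ denotes the maximum size of a matching in a graph $G$. A conservative change of a partial assignment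 $\varphi$ w.r.t. $F$ is either extending $\varphi$ by $v\mapsto\varepsilon$ for some $v\in\mathrm{var}(F)\setminus\mathrm{var}(\varphi)$, $\varepsilon\in D_v$, or changing the value of some $v\in\mathrm{var}(\varphi)$ to another $\varepsilon\in D_v\setminus\{\varphi(v)\}$ such that every clause of $F$ satisfied by $\varphi$ is also satisfied by the new assignment. *)

(* Defs.v *)
From mathcomp Require Import all_boot all_algebra.
From mathcomp Require Import finmap multiset.

Set Implicit Arguments.
Unset Strict Implicit.
Unset Printing Implicit Defensive.

Local Open Scope fset_scope.
Local Open Scope fmap_scope.
Local Open Scope nat_scope.

(** * Bipartite graphs and matchings *)

Record bigraph (L R : choiceType) := BiGraph {
  left_nodes : {fset L};
  right_nodes : {fset R};
  edges : {fset L * R}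
}.

Definition is_matching (L R : choiceType) (G : bigraph L R)
    (M : {fset L * R}) : bool :=
  [&& M `<=` edges G,
      uniq [seq x.1 | x <- enum_fset M] &
      uniq [seq x.2 | x <- enum_fset M]].

Definition matching_number (L R : choiceType) (G : bigraph L R) : nat :=
  \max_(M <- fpowerset (edges G) | is_matching G M) #|` M|.

(** * Generalised multi-clause-sets *)

Section ClauseSets.
Context {V E : choiceType}.

(* [D v] is the domain of the variable [v].  A literal is a pair (v, e),
   meaning "v <> e", and clauses are finite sets of literals. *)
Variable D : V -> {fset E}.

Definition is_clause (C : {fset V * E}) : Prop :=
  (forall x, x \in C -> x.2 \in D x.1) /\
  (forall x y, x \in C -> y \in C -> x.1 = y.1 -> x = y).

(* [F C] is the number of occurrences of [C]. *)
Definition multi_clause_set (F : {mset {fset V * E}}%mset) : Prop :=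
  forall C, 0 < F C -> is_clause C.

Definition clause_var (C : {fset V * E}) : {fset V} := [fset x.1 | x in C].

Definition cls_var (F : {mset {fset V * E}}%mset) : {fset V} :=
  \bigcup_(C <- finsupp F) clause_var C.

Definition partial_assignment (phi : {fmap V -> E}) : Prop :=
  forall v e, phi.[? v] = Some e -> e \in D v.

Definition sat_literal (phi : {fmap V -> E}) (x : V * E) : bool :=
  if phi.[? x.1] is Some e then e != x.2 else false.

Definition sat_clause (phi : {fmap V -> E}) (C : {fset V * E}) : bool :=
  has (sat_literal phi) (enum_fset C).

Definition clause_nodes (F : {mset {fset V * E}}%mset) :
    {fset {fset V * E} * nat} :=
  [fset (C, i) | C : {fset V * E} in finsupp F, i : nat in iota 1 (F C)].

Definition var_nodes (F : {mset {fset V * E}}%mset) : {fset V * nat} :=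
  [fset (v, j) | v : V in cls_var F, j : nat in iota 1 (#|` D v| - 1)].

Definition occ_graph (F : {mset {fset V * E}}%mset) :
    bigraph ({fset V * E} * nat)%type (V * nat)%type :=
  {| left_nodes := clause_nodes F;
     right_nodes := var_nodes F;
     edges := [fset e in clause_nodes F `*` var_nodes F |
                e.2.1 \in clause_var e.1.1] |}.

Definition sat_graph (phi : {fmap V -> E}) (F : {mset {fset V * E}}%mset) :
    bigraph ({fset V * E} * nat)%type (V * nat)%type :=
  {| left_nodes := left_nodes (occ_graph F);
     right_nodes := right_nodes (occ_graph F);
     edges := [fset e in edges (occ_graph F) |
                has (fun x => (x.1 == e.2.1) && sat_literal phi x)
                    (enum_fset e.1.1)] |}.

Definition matching_maximum (F : {mset {fset V * E}}%mset)
    (phi : {fmap V -> E}) : Prop :=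
  matching_number (sat_graph phi F) = matching_number (occ_graph F).

(* The pair [x = (v, e)] stands for the change of [phi] to [phi.[v <- e]]. *)
Definition change (phi : {fmap V -> E}) (x : V * E) : {fmap V -> E} :=
  phi.[x.1 <- x.2].

Definition conservative (F : {mset {fset V * E}}%mset)
    (phi : {fmap V -> E}) (x : V * E) : Prop :=
  [/\ x.1 \in cls_var F, x.1 \notin domf phi & x.2 \in D x.1] \/
  [/\ x.1 \in domf phi, x.2 \in D x.1, phi.[? x.1] <> Some x.2 &
      forall C, 0 < F C -> sat_clause phi C -> sat_clause (change phi x) C].

Fixpoint conservative_seq (F : {mset {fset V * E}}%mset)
    (phi : {fmap V -> E}) (s : seq (V * E)) : Prop :=
  if s is x :: s' then
    conservative F phi x /\ conservative_seq F (change phi x) s'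
  else True.

End ClauseSets.

(** * A model of polynomial-time computation

   A program is a finite list of bodies of mutually recursive first-order
   functions over binary trees (S-expressions); variables are de Bruijn
   indices into the environment.  Trees are immutable, so on a pointer machine
   every construct takes a bounded number of elementary operations (the bound
   depending only on the program), trees being shared and not copied.  A shared
   tree can be exponentially larger than the time spent building it; for this
   reason the resource bound [computes_within] also charges for writing out
   the result.  With this convention the functions computable within a
   polynomial bound are the usual polynomial-time computable functions. *)

Inductive tree := Leaf | Node of tree & tree.

Fixpoint tree_size (t : tree) : nat :=
  if t is Node a b then (tree_size a + tree_size b).+1 else 1.

Inductive exp :=
  | EVar of nat
  | ELeaf
  | ENode of exp & exp
  (* [ECase e e0 e1]: if [e] evaluates to [Leaf], continue with [e0], and if
     it evaluates to [Node a b], with [e1] where index 0 is [a] and 1 is [b] *)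
  | ECase of exp & exp & exp
  | ELet of exp & exp
  | ECall of nat & seq exp.

Definition program := seq exp.

(* [eval p env e r n]: in the environment [env], [e] evaluates to [r] in [n]
   steps. *)
Inductive eval (p : program) : seq tree -> exp -> tree -> nat -> Prop :=
  | eval_var env i : eval p env (EVar i) (nth Leaf env i) 1
  | eval_leaf env : eval p env ELeaf Leaf 1
  | eval_node env e1 e2 r1 r2 n1 n2 :
      eval p env e1 r1 n1 -> eval p env e2 r2 n2 ->
      eval p env (ENode e1 e2) (Node r1 r2) (n1 + n2).+1
  | eval_case_leaf env e e0 e1 r n n0 :
      eval p env e Leaf n -> eval p env e0 r n0 ->
      eval p env (ECase e e0 e1) r (n + n0).+1
  | eval_case_node env e e0 e1 a b r n n1 :
      eval p env e (Node a b) n -> eval p [:: a, b & env] e1 r n1 ->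
      eval p env (ECase e e0 e1) r (n + n1).+1
  | eval_let env e1 e2 r1 r2 n1 n2 :
      eval p env e1 r1 n1 -> eval p (r1 :: env) e2 r2 n2 ->
      eval p env (ELet e1 e2) r2 (n1 + n2).+1
  | eval_call env f es rs r n1 n2 :
      evals p env es rs n1 -> eval p rs (nth ELeaf p f) r n2 ->
      eval p env (ECall f es) r (n1 + n2).+1
with evals (p : program) : seq tree -> seq exp -> seq tree -> nat -> Prop :=
  | evals_nil env : evals p env [::] [::] 0
  | evals_cons env e es r rs n1 n2 :
      eval p env e r n1 -> evals p env es rs n2 ->
      evals p env (e :: es) (r :: rs) (n1 + n2).

(* Function 0 is the entry point. *)
Definition computes_within (p : program) (T : {poly nat}) (x y : tree) : Prop :=
  exists2 n, eval p [:: x] (nth ELeaf p 0) y n &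
             n + tree_size y <= T.[tree_size x]%R.

(** * Representation of inputs and outputs

   An instance is presented by lists enumerating the finite objects involved,
   in an arbitrary order. *)

Section Encoding.
Context {V E : choiceType}.

Fixpoint tree_of_seq (T : Type) (c : T -> tree) (s : seq T) : tree :=
  if s is x :: s' then Node (c x) (tree_of_seq c s') else Leaf.

(* The names of variables and values are given by [cV] and [cE]. *)
Variables (cV : V -> tree) (cE : E -> tree).

Definition tree_of_literal (x : V * E) : tree := Node (cV x.1) (cE x.2).

Definition tree_of_domain (d : V * seq E) : tree :=
  Node (cV d.1) (tree_of_seq cE d.2).

Definition tree_of_input (ds : seq (V * seq E)) (cs : seq (seq (V * E)))
    (ps : seq (V * E)) : tree :=
  Node (tree_of_seq tree_of_domain ds)
    (Node (tree_of_seq (tree_of_seq tree_of_literal) cs)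
          (tree_of_seq tree_of_literal ps)).

Definition tree_of_output (s : seq (V * E)) : tree :=
  tree_of_seq tree_of_literal s.

Definition lists_domains (D : V -> {fset E}) (F : {mset {fset V * E}}%mset)
    (ds : seq (V * seq E)) : Prop :=
  perm_eq [seq d.1 | d <- ds] (enum_fset (cls_var F)) /\
  (forall d, d \in ds -> perm_eq d.2 (enum_fset (D d.1))).

(* Each clause [C] is listed [F C] times. *)
Definition lists_clauses (F : {mset {fset V * E}}%mset)
    (cs : seq (seq (V * E))) : Prop :=
  all uniq cs /\ (forall C, count_mem C [seq [fset x in c] | c <- cs] = F C).

Definition lists_assignment (phi : {fmap V -> E}) (ps : seq (V * E)) : Prop :=
  uniq ps /\ (forall v e, (v, e) \in ps <-> phi.[? v] = Some e).

End Encoding.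

(* Main.v *)
(**
  The state consists of a partial assignment phi that is total on var(F) and of
  a matching of B_phi(F), recorded by giving each listed clause at most one
  variable.  A breadth-first search from the unmatched clauses (a clause matched
  to a reached variable is reached, a variable of a reached clause is reached)
  either reaches no variable v with fewer than |D_v| - 1 matched clauses, and then
  the matching is maximum in B(F) by a Koenig-type count, or it reaches such a v
  and one walks back along the search from v.  If some unmatched clause is
  satisfied by phi at v, match it to v and stop.  Otherwise the clause c through
  which v was reached is rematched to v, after changing phi(v), if necessary, to
  a value that satisfies at v both c and all clauses matched to v; this is
  conservative, because a clause satisfied by phi at v is now either matched to v
  or matched to, and satisfied at, another variable.  The variable which c leaves
  has room again and is closer to the source.  So each phase matches one more
  clause, and as many phases as there are clauses suffice.
*)

Require Import Defs.
From mathcomp Require Import all_boot all_algebra.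
From mathcomp Require Import finmap multiset.
From mathcomp Require Import zify.

Set Implicit Arguments.
Unset Strict Implicit.
Unset Printing Implicit Defensive.

(** * Polynomial-time computable tree functions *)

(** The value to which phi(v) is changed exists because, with room at v, the moved clause and those
    matched to v number at most |D_v| - 1, and each excludes at most one value. Walking back needs
    no recursion: the search list is stored latest first, so predecessors lie further down and one
    left fold follows the path. The running time shapes the rest. One program has to serve all types
    of variables and values, so [ptime] speaks of families over an index type of instances, seen
    only through their codes. A loop whose step is polynomial need not be polynomial, since growth
    can compound. The inner loops are harmless: one step adds an amount depending on the input and
    on the list element, not on the accumulator. For a phase the local bound on growth does involve
    the state it starts from; the loop over phases therefore takes its size bound from the
    correctness invariant [good], which ties every part of the state to the input. This is why
    correctness comes before the running time. *)

Lemma leq_exp2rW m n d : m <= n -> m ^ d <= n ^ d.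
Proof. by case: d => [//|d] le; rewrite leq_exp2r. Qed.

(** The base [s + 2] is at least 2 even for [s = 0], so constants and sums are absorbed by a larger
    exponent and one number [d] describes every bound. *)
Definition polybounded (T : nat -> nat) := exists d, forall s, T s <= (s + 2) ^ d.

Lemma polybounded_const c : polybounded (fun=> c).
Proof.
exists c => s; apply: leq_trans (ltnW (ltn_expl c (isT : 1 < 2))) _.
by apply: leq_exp2rW; rewrite leq_addl.
Qed.

Lemma polybounded_id : polybounded id.
Proof. by exists 1 => s; rewrite expn1 leq_addr. Qed.

Lemma polybounded_add T U :
  polybounded T -> polybounded U -> polybounded (fun s => T s + U s).
Proof.
move=> [a Ha] [b Hb]; exists (a + b).+1 => s.
have h : (s + 2) ^ a + (s + 2) ^ b <= (s + 2) ^ (a + b) + (s + 2) ^ (a + b).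
  by apply: leq_add; apply: leq_pexp2l; rewrite ?addn2 ?leq_addr ?leq_addl.
apply: leq_trans (leq_add (Ha s) (Hb s)) (leq_trans h _).
by rewrite addnn -mul2n expnS leq_mul2r leq_addl orbT.
Qed.

Lemma polybounded_mul T U :
  polybounded T -> polybounded U -> polybounded (fun s => T s * U s).
Proof.
by move=> [a Ha] [b Hb]; exists (a + b) => s; rewrite expnD leq_mul.
Qed.

Lemma polybounded_exp T d : polybounded T -> polybounded (fun s => (T s + 2) ^ d).
Proof.
move=> HT; have [a Ha] := polybounded_add HT (polybounded_const 2).
by exists (a * d) => s; rewrite expnM; apply: leq_exp2rW.
Qed.

Ltac polybound := repeat first
  [ exact: polybounded_const | exact: polybounded_id
  | apply: polybounded_add | apply: polybounded_mul | apply: polybounded_exp ].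

Lemma tree_size_gt0 t : 0 < tree_size t.
Proof. by case: t. Qed.

(* [f x] can be computed from [e x] in polynomial time.  The quantification over
   the surrounding program [p0 ++ _ ++ r] lets programs be linked by plain
   concatenation, without renumbering of calls. *)
Definition ptime (X : Type) (e f : X -> tree) : Prop :=
  forall k, exists (q : program) (b : exp) (d : nat),
  forall p0 r x, size p0 = k ->
  exists2 n, eval (p0 ++ q ++ r) [:: e x] b (f x) n &
             n + tree_size (f x) <= (tree_size (e x) + 2) ^ d.

Lemma ptime_weaken X (e f : X -> tree) k (T : nat -> nat) (q : program) (b : exp) :
  polybounded T ->
  (forall p0 r x, size p0 = k ->
  exists2 n, eval (p0 ++ q ++ r) [:: e x] b (f x) n &
             n + tree_size (f x) <= T (tree_size (e x))) ->
  exists (q : program) (b : exp) (d : nat),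
  forall p0 r x, size p0 = k ->
  exists2 n, eval (p0 ++ q ++ r) [:: e x] b (f x) n &
             n + tree_size (f x) <= (tree_size (e x) + 2) ^ d.
Proof.
move=> [d Hd] H; exists q, b, d => p0 r x sz.
by have [n ev le] := H p0 r x sz; exists n => //; apply: leq_trans le (Hd _).
Qed.

(** A body [b] is meant for an environment with a single entry. Appended to its own block it becomes
    the function with index [k + size q], which can be called from any environment. *)
Lemma ptime_fun X (e f : X -> tree) : ptime e f ->
  forall k, exists (q : program) (i : nat) (d : nat),
  forall p0 r x, size p0 = k ->
  exists2 n, eval (p0 ++ q ++ r) [:: e x] (nth ELeaf (p0 ++ q ++ r) i) (f x) n &
             n + tree_size (f x) <= (tree_size (e x) + 2) ^ d.
Proof.
move=> H k; have [q [b [d Hd]]] := H k.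
exists (rcons q b), (k + size q), d => p0 r x sz.
have -> : nth ELeaf (p0 ++ rcons q b ++ r) (k + size q) = b.
  by rewrite nth_cat -sz ltnNge leq_addr /= addKn cat_rcons nth_cat ltnn subnn.
by rewrite cat_rcons; apply: Hd.
Qed.

Lemma ptime_size X (e f : X -> tree) : ptime e f ->
  exists d, forall x, tree_size (f x) <= (tree_size (e x) + 2) ^ d.
Proof.
move=> /(_ 0) [q [b [d Hd]]]; exists d => x.
have [n _] := Hd [::] [::] x erefl.
by apply: leq_trans; rewrite leq_addl.
Qed.

Lemma ptime_id X (e : X -> tree) : ptime e e.
Proof.
move=> k; apply: (@ptime_weaken _ _ _ _ (fun s => 1 + s) [::] (EVar 0)).
  by polybound.
by move=> p0 r x _; exists 1 => //; apply: eval_var.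
Qed.

Lemma ptime_leaf X (e : X -> tree) : ptime e (fun=> Leaf).
Proof.
move=> k; apply: (@ptime_weaken _ _ _ _ (fun s => 2) [::] ELeaf).
  by polybound.
by move=> p0 r x _; exists 1 => //; apply: eval_leaf.
Qed.

(** Here it matters that [ptime] bounds [tree_size (f x)] along with the steps: the second program
    costs a polynomial in that size, which, trees being shared, the number of steps alone would not
    control. *)
Lemma ptime_comp X (e f g : X -> tree) : ptime e f -> ptime f g -> ptime e g.
Proof.
move=> Hf Hg k; have [q1 [b1 [d1 H1]]] := Hf k.
have [q2 [i [d2 H2]]] := ptime_fun Hg (k + size q1).
apply: (@ptime_weaken _ _ _ _
  (fun s => (s + 2) ^ d1 + ((s + 2) ^ d1 + 2) ^ d2 + 1) (q1 ++ q2)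
  (ECall i [:: b1])).
  by polybound.
move=> p0 r x sz.
have [n1 ev1 le1] := H1 p0 (q2 ++ r) x sz.
have [|n2 ev2 le2] := H2 (p0 ++ q1) r x; first by rewrite size_cat sz.
exists (n1 + 0 + n2).+1.
  apply: eval_call; first by apply: evals_cons; [rewrite -catA; exact: ev1 | exact: evals_nil].
  by move: ev2; rewrite -!catA.
have le3 : (tree_size (f x) + 2) ^ d2 <= ((tree_size (e x) + 2) ^ d1 + 2) ^ d2.
  apply: leq_exp2rW; rewrite leq_add2r.
  by apply: leq_trans le1; rewrite leq_addl.
lia.
Qed.

Lemma ptime_node X (e f g : X -> tree) : ptime e f -> ptime e g ->
  ptime e (fun x => Node (f x) (g x)).
Proof.
move=> Hf Hg k; have [q1 [b1 [d1 H1]]] := Hf k.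
have [q2 [b2 [d2 H2]]] := Hg (k + size q1).
apply: (@ptime_weaken _ _ _ _ (fun s => (s + 2) ^ d1 + (s + 2) ^ d2 + 2)
  (q1 ++ q2) (ENode b1 b2)).
  by polybound.
move=> p0 r x sz.
have [n1 ev1 le1] := H1 p0 (q2 ++ r) x sz.
have [|n2 ev2 le2] := H2 (p0 ++ q1) r x; first by rewrite size_cat sz.
exists (n1 + n2).+1.
  apply: eval_node; first by rewrite -catA.
  by move: ev2; rewrite -!catA.
rewrite /=; lia.
Qed.

Lemma ptime_fst X (e f g : X -> tree) : ptime e (fun x => Node (f x) (g x)) -> ptime e f.
Proof.
move/ptime_comp; apply=> k.
apply: (@ptime_weaken _ _ _ _ (fun s => 3 + s) [::] (ECase (EVar 0) ELeaf (EVar 0))).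
  by polybound.
move=> p0 r x _; exists 3 => /=; last by lia.
by apply: (@eval_case_node _ _ _ _ _ _ _ _ 1 1); [exact: eval_var | exact: eval_var].
Qed.

Lemma ptime_snd X (e f g : X -> tree) : ptime e (fun x => Node (f x) (g x)) -> ptime e g.
Proof.
move/ptime_comp; apply=> k.
apply: (@ptime_weaken _ _ _ _ (fun s => 3 + s) [::] (ECase (EVar 0) ELeaf (EVar 1))).
  by polybound.
move=> p0 r x _; exists 3 => /=; last by lia.
by apply: (@eval_case_node _ _ _ _ _ _ _ _ 1 1); [exact: eval_var | exact: eval_var].
Qed.

(** Binding the variables of a case becomes a change of index type: the branch is a [ptime] fact
    over pairs of an input and a matched value, and it is called on the single tree that packs the
    two. *)
Lemma ptime_match X (e : X -> tree) (A : X -> Type) (hd tl : forall x, A x -> tree)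
    (o : forall x, option (A x)) (f : X -> tree) (g : forall x, A x -> tree) :
  ptime e (fun x => if o x is Some a then Node (hd x a) (tl x a) else Leaf) ->
  ptime e f ->
  ptime (fun p : {x : X & A x} =>
           Node (e (tag p)) (Node (hd _ (tagged p)) (tl _ (tagged p))))
        (fun p => g _ (tagged p)) ->
  ptime e (fun x => if o x is Some a then g x a else f x).
Proof.
move=> Ho Hf Hg k; have [q0 [b0 [d0 H0]]] := Ho k.
have [q1 [b1 [d1 H1]]] := Hf (k + size q0).
have [q2 [i [d2 H2]]] := ptime_fun Hg (k + size q0 + size q1).
apply: (@ptime_weaken _ _ _ _
  (fun s => (s + 2) ^ d0 + (s + 2) ^ d1 + (s + (s + 2) ^ d0 + 1 + 2) ^ d2 + 10)
  (q0 ++ q1 ++ q2)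
  (* Inside the case the environment reads head, tail, input, whence [EVar 2] for the input. *)
  (ECase b0 b1 (ECall i [:: ENode (EVar 2) (ENode (EVar 0) (EVar 1))]))).
  by polybound.
move=> p0 r x sz.
have [n0] := H0 p0 (q1 ++ q2 ++ r) x sz.
have [|n1] := H1 (p0 ++ q0) (q2 ++ r) x; first by rewrite size_cat sz.
rewrite -!catA.
case: (o x) => [a|] ev1 le1 ev0 le0; last first.
  exists (n0 + n1).+1; first exact: eval_case_leaf ev0 ev1.
  lia.
have [|n2] := H2 ((p0 ++ q0) ++ q1) r (existT _ x a).
  by rewrite !size_cat sz.
rewrite -!catA /= => ev2 le2.
exists (n0 + (5 + 0 + n2).+1).+1.
  apply: eval_case_node ev0 _; apply: eval_call ev2.
  apply: evals_cons; last exact: evals_nil.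
  apply: (@eval_node _ _ _ _ _ _ 1 3); first exact: eval_var.
  by apply: (@eval_node _ _ _ _ _ _ 1 1); exact: eval_var.
move: le0 => /= le0.
have le3 : (tree_size (e x) + (tree_size (hd x a) + tree_size (tl x a)).+1).+1 + 2
     <= tree_size (e x) + (tree_size (e x) + 2) ^ d0 + 1 + 2 by lia.
have := leq_exp2rW d2 le3; lia.
Qed.

Lemma ptime_reindex (X Y : Type) (h : Y -> X) (e f : X -> tree) :
  ptime e f -> ptime (fun y => e (h y)) (fun y => f (h y)).
Proof.
move=> H k; have [q [b [d Hd]]] := H k; exists q, b, d => p0 r y; exact: Hd.
Qed.

(** * Loops over lists *)

Section Fold.
Variables (X : Type) (e : X -> tree) (T S : X -> Type).
Variables (cT : forall x, T x -> tree) (cS : forall x, S x -> tree).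
Variables (l : forall x, seq (T x)) (s0 : forall x, S x).
Variable step : forall x, S x -> T x -> S x.

Lemma tree_size_seq_mem (A : eqType) (c : A -> tree) a s :
  a \in s -> tree_size (c a) <= tree_size (tree_of_seq c s).
Proof.
elim: s => //= b s IH; rewrite inE => /orP[/eqP->|/IH]; lia.
Qed.

(** A polynomial-time step may square the size of the accumulator, so its iterates can explode;
    hence the bound [B] along all prefixes of the list. The loop is a new function [j] of three
    arguments: input, remaining list, accumulator. *)
Lemma ptime_foldl (B : nat -> nat) : polybounded B ->
  (forall x k, k <= size (l x) ->
    tree_size (cS (foldl (@step x) (s0 x) (take k (l x)))) <= B (tree_size (e x))) ->
  ptime e (fun x => tree_of_seq (@cT x) (l x)) ->
  ptime e (fun x => cS (s0 x)) ->
  ptime (fun p : {x : X & (T x * S x)%type} =>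
           Node (e (tag p)) (Node (cT (tagged p).1) (cS (tagged p).2)))
        (fun p => cS (step (tagged p).2 (tagged p).1)) ->
  ptime e (fun x => cS (foldl (@step x) (s0 x) (l x))).
Proof.
move=> pB HB Hl H0 Hs k; have [q0 [b0 [d0 E0]]] := Hl k.
have [q1 [b1 [d1 E1]]] := H0 (k + size q0).
have [q2 [i [d2 E2]]] := ptime_fun Hs (k + size q0 + size q1).
pose j := k + size q0 + size q1 + size q2.
pose body := ECase (EVar 1) (EVar 2)
  (ECall j [:: EVar 2; EVar 1;
     ECall i [:: ENode (EVar 2) (ENode (EVar 0) (EVar 4))]]).
(* [St] bounds one round: a constant for the case and the calls, and the step program on a packed
   argument made of the input, a list element and an accumulator. *)
pose St s := 20 + (s + (s + 2) ^ d0 + B s + 2 + 2) ^ d2.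
apply: (@ptime_weaken _ _ _ _
  (fun s => (s + 2) ^ d0 + (s + 2) ^ d1 + ((s + 2) ^ d0 * St s + 20) + B s + 10)
  (q0 ++ q1 ++ q2 ++ [:: body])
  (ECall j [:: EVar 0; b0; b1])).
  by rewrite /St; polybound.
move=> p0 r x sz.
have [n0] := E0 p0 (q1 ++ q2 ++ body :: r) x sz.
have [|n1] := E1 (p0 ++ q0) (q2 ++ body :: r) x; first by rewrite size_cat sz.
have sz2 : size ((p0 ++ q0) ++ q1) = k + size q0 + size q1.
  by rewrite !size_cat sz.
have E3 t s := E2 _ (body :: r) (existT _ x (t, s)) sz2.
move: E3; rewrite -!catA /= => E3 ev1 le1 ev0 le0.
set P := p0 ++ _ in E3 ev1 ev0 *.
have bodyE : nth ELeaf P j = body.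
  rewrite /P !catA nth_cat !size_cat sz -/j.
  by rewrite ltnn subnn.
(* Induction on the number [m] of elements still to be read; the accumulator is the fold over those
   already read. *)
have loop : forall m, m <= size (l x) -> exists2 n,
   eval P [:: e x; tree_of_seq (@cT x) (drop (size (l x) - m) (l x));
      cS (foldl (@step x) (s0 x) (take (size (l x) - m) (l x)))] body
    (cS (foldl (@step x) (s0 x) (l x))) n &
    n <= m * St (tree_size (e x)) + 20.
  elim=> [|m IH] lem.
    rewrite subn0 drop_size take_size; exists 3 => //.
    by apply: (@eval_case_leaf _ _ _ _ _ _ 1 1); exact: eval_var.
  have [n evn len] := IH (ltnW lem).
  have [t0 _] : exists t0 : T x, True by case: (l x) lem => // a; exists a.
  set i0 := size (l x) - m.+1 in evn *.
  have i0S : size (l x) - m = i0.+1 by rewrite /i0; lia.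
  have lt0 : i0 < size (l x) by rewrite /i0; lia.
  rewrite i0S in evn.
  pose t := nth t0 (l x) i0.
  rewrite (take_nth t0 lt0) foldl_rcons -/t in evn.
  rewrite (drop_nth t0 lt0) -/t /=.
  set s := foldl _ _ (take i0 _) in evn *.
  have [n2 ev2 le2] := E3 t s.
  exists (1 + (1 + (1 + ((5 + 0 + n2).+1 + 0)) + n).+1).+1.
    apply: eval_case_node; first exact: eval_var.
    apply: eval_call; last by rewrite bodyE; exact: evn.
    apply: evals_cons; first exact: eval_var.
    apply: evals_cons; first exact: eval_var.
    apply: evals_cons; last exact: evals_nil.
    apply: eval_call ev2.
    apply: evals_cons; last exact: evals_nil.
    apply: (@eval_node _ _ _ _ _ _ 1 3); first exact: eval_var.
    by apply: (@eval_node _ _ _ _ _ _ 1 1); exact: eval_var.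
  have les : tree_size (cS s) <= B (tree_size (e x)) by apply: HB; apply: ltnW.
  have let_ : tree_size (cT t) <= (tree_size (e x) + 2) ^ d0.
    apply: (@leq_trans (tree_size (tree_of_seq (@cT x) (l x)))); last by lia.
    rewrite /t; elim: (l x) (i0) lt0 => //= a l' IHl [|i1] /= lt1; first by lia.
    by have := IHl i1 lt1; lia.
  have le3 : (tree_size (e x) + (tree_size (cT t) + tree_size (cS s)).+1).+1 + 2
     <= tree_size (e x) + (tree_size (e x) + 2) ^ d0 + B (tree_size (e x)) + 2 + 2
     by lia.
  have := leq_exp2rW d2 le3.
  rewrite mulSn {1}/St; lia.
have [n] := loop _ (leqnn _).
rewrite subnn drop0 take0 /= => evn len.
exists (1 + (n0 + (n1 + 0)) + n).+1.
  apply: eval_call; last by rewrite bodyE; exact: evn.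
  apply: evals_cons; first exact: eval_var.
  by apply: evals_cons ev0 _; apply: evals_cons ev1 _; apply: evals_nil.
have := HB x _ (leqnn _); rewrite take_size => leB.
have lel : size (l x) <= (tree_size (e x) + 2) ^ d0.
  apply: (@leq_trans (tree_size (tree_of_seq (@cT x) (l x)))); last by lia.
  by elim: (l x) => //= a l' IHl; lia.
have : size (l x) * St (tree_size (e x)) <= (tree_size (e x) + 2) ^ d0 * St (tree_size (e x)).
  by rewrite leq_mul2r lel orbT.
lia.
Qed.

End Fold.

Definition tree_of_bool (b : bool) : tree := if b then Node Leaf Leaf else Leaf.

Definition tree_of_option (A : Type) (c : A -> tree) (o : option A) : tree :=
  if o is Some a then Node (c a) Leaf else Leaf.

Definition tree_of_pair (A B : Type) (cA : A -> tree) (cB : B -> tree)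
  (x : A * B) : tree := Node (cA x.1) (cB x.2).

Lemma ptime_eq X (e f g : X -> tree) : f =1 g -> ptime e f -> ptime e g.
Proof.
move=> fg H k; have [q [b [d Hd]]] := H k; exists q, b, d => p0 r x.
by rewrite -fg; apply: Hd.
Qed.

Lemma ptime_ext X Y (h : Y -> X) (e f : X -> tree) (g : Y -> tree) :
  ptime e f -> ptime (fun y => Node (e (h y)) (g y)) (fun y => f (h y)).
Proof.
move=> Hf; apply: (@ptime_comp _ _ (fun y => e (h y))).
  exact: ptime_fst (ptime_id _).
exact: ptime_reindex Hf.
Qed.

Lemma tree_size_take (A : Type) (c : A -> tree) k l :
  tree_size (tree_of_seq c (take k l)) <= tree_size (tree_of_seq c l).
Proof. by elim: l k => [|a l IH] [|k] //=; have := IH k; lia. Qed.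

Lemma size_tree_size (A : Type) (c : A -> tree) l :
  size l <= tree_size (tree_of_seq c l).
Proof. by elim: l => //= a l IH; lia. Qed.

(** Increments depend on [n] and on the list element, never on the accumulator, so they add up
    instead of compounding. The factor [tree_size (tree_of_seq cA l)] stands for the number of
    rounds. *)
Lemma foldl_additive_growth (A B : Type) (cA : A -> tree) (cB : B -> tree)
    (step : B -> A -> B) (l : seq A) (s : B) n d :
  (forall s t, tree_size (cB (step s t)) <=
     tree_size (cB s) + (n + tree_size (cA t) + 2) ^ d) ->
  tree_size (cB (foldl step s l)) <=
    tree_size (cB s) + tree_size (tree_of_seq cA l) *
     (n + tree_size (tree_of_seq cA l) + 2) ^ d.
Proof.
move=> H; set U := tree_size (tree_of_seq _ _) in |- *.
suff h l' s' : tree_size (tree_of_seq cA l') <= U ->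
    tree_size (cB (foldl step s' l')) <=
    tree_size (cB s') + size l' * (n + U + 2) ^ d.
  apply: leq_trans (h _ _ (leqnn _)) _.
  by rewrite leq_add2l leq_mul2r size_tree_size orbT.
elim: l' s' => [|a l' IH] s' /= le; first by rewrite mul0n addn0.
apply: leq_trans (IH _ _) _; first by lia.
have le2 : n + tree_size (cA a) + 2 <= n + U + 2 by lia.
have := leq_exp2rW d le2; have := H s' a; lia.
Qed.

(** * Combinators for booleans, options and lists *)

Section TypedCombinators.
Variables (X : Type) (e : X -> tree).
Variables (A B : X -> Type).
Variables (cA : forall x, A x -> tree) (cB : forall x, B x -> tree).

Lemma ptime_true : ptime e (fun=> tree_of_bool true).
Proof. exact: ptime_node (ptime_leaf _) (ptime_leaf _). Qed.

Lemma ptime_false : ptime e (fun=> tree_of_bool false).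
Proof. exact: ptime_leaf. Qed.

Lemma ptime_if (b : X -> bool) (f g : forall x, A x) :
  ptime e (fun x => tree_of_bool (b x)) ->
  ptime e (fun x => cA (f x)) -> ptime e (fun x => cA (g x)) ->
  ptime e (fun x => cA (if b x then f x else g x)).
Proof.
move=> Hb Hf Hg.
apply: (@ptime_eq _ _ (fun x => if (if b x then Some tt else None) is Some _
                              then cA (f x) else cA (g x))).
  by move=> x; case: (b x).
apply: (@ptime_match _ e (fun=> unit) (fun _ _ => Leaf) (fun _ _ => Leaf)
  (fun x => if b x then Some tt else None) _ (fun x _ => cA (f x))) => //.
  by apply: ptime_eq Hb => x; case: (b x).
exact: (ptime_ext (fun p : {_ : X & unit} => tag p) _ Hf).
Qed.

Lemma ptime_option (o : forall x, option (A x)) (f : forall x, B x)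
    (g : forall x, A x -> B x) :
  ptime e (fun x => tree_of_option (@cA x) (o x)) ->
  ptime e (fun x => cB (f x)) ->
  ptime (fun p : {x : X & A x} => Node (e (tag p)) (cA (tagged p)))
        (fun p => cB (g _ (tagged p))) ->
  ptime e (fun x => cB (if o x is Some a then g x a else f x)).
Proof.
move=> Ho Hf Hg.
apply: (@ptime_eq _ _ (fun x => if o x is Some a then cB (g x a) else cB (f x))).
  by move=> x; case: (o x).
apply: (@ptime_match _ e A cA (fun _ _ => Leaf) o _ (fun x a => cB (g x a))) => //.
apply: ptime_comp Hg.
apply: ptime_node; first exact: ptime_fst (ptime_id _).
exact: ptime_fst (ptime_snd (ptime_id _)).
Qed.

Lemma ptime_none : ptime e (fun x => tree_of_option (@cA x) None).
Proof. exact: ptime_leaf. Qed.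

Lemma ptime_some (f : forall x, A x) : ptime e (fun x => cA (f x)) ->
  ptime e (fun x => tree_of_option (@cA x) (Some (f x))).
Proof. by move=> Hf; apply: ptime_node Hf (ptime_leaf _). Qed.

Lemma ptime_nil : ptime e (fun x => tree_of_seq (@cA x) [::]).
Proof. exact: ptime_leaf. Qed.

Lemma ptime_cons (f : forall x, A x) (l : forall x, seq (A x)) :
  ptime e (fun x => cA (f x)) -> ptime e (fun x => tree_of_seq (@cA x) (l x)) ->
  ptime e (fun x => tree_of_seq (@cA x) (f x :: l x)).
Proof. exact: ptime_node. Qed.

Lemma ptime_ohead (l : forall x, seq (A x)) :
  ptime e (fun x => tree_of_seq (@cA x) (l x)) ->
  ptime e (fun x => tree_of_option (@cA x) (ohead (l x))).
Proof.
move=> Hl.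
pose o x := if l x is a :: s then Some (a, s) else None.
apply: (@ptime_eq _ _ (fun x => if o x is Some a then Node (cA a.1) Leaf else Leaf)).
  by move=> x; rewrite /o; case: (l x).
apply: (@ptime_match _ e (fun x => A x * seq (A x))%type (fun x a => cA a.1)
  (fun x a => tree_of_seq (@cA x) a.2) o _ (fun x a => Node (cA a.1) Leaf)).
- by apply: ptime_eq Hl => x; rewrite /o; case: (l x).
- exact: ptime_leaf.
- apply: ptime_node (ptime_leaf _); exact: ptime_fst (ptime_snd (ptime_id _)).
Qed.

Lemma ptime_behead (l : forall x, seq (A x)) :
  ptime e (fun x => tree_of_seq (@cA x) (l x)) ->
  ptime e (fun x => tree_of_seq (@cA x) (behead (l x))).
Proof.
move=> Hl.
pose o x := if l x is a :: s then Some (a, s) else None.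
apply: (@ptime_eq _ _
  (fun x => if o x is Some a then tree_of_seq (@cA x) a.2 else Leaf)).
  by move=> x; rewrite /o; case: (l x).
apply: (@ptime_match _ e (fun x => A x * seq (A x))%type (fun x a => cA a.1)
  (fun x a => tree_of_seq (@cA x) a.2) o _ (fun x a => tree_of_seq (@cA x) a.2)).
- by apply: ptime_eq Hl => x; rewrite /o; case: (l x).
- exact: ptime_leaf.
- exact: ptime_snd (ptime_snd (ptime_id _)).
Qed.

(** Replaces the bound on all intermediate accumulators by a condition on a single step. *)
Lemma ptime_foldl_additive d (l : forall x, seq (A x)) (s0 : forall x, B x)
    (step : forall x, B x -> A x -> B x) :
  (forall x s t, tree_size (cB (step x s t)) <=
     tree_size (cB s) + (tree_size (e x) + tree_size (cA t) + 2) ^ d) ->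
  ptime e (fun x => tree_of_seq (@cA x) (l x)) ->
  ptime e (fun x => cB (s0 x)) ->
  ptime (fun p : {x : X & (A x * B x)%type} =>
           Node (e (tag p)) (Node (cA (tagged p).1) (cB (tagged p).2)))
        (fun p => cB (step _ (tagged p).2 (tagged p).1)) ->
  ptime e (fun x => cB (foldl (step x) (s0 x) (l x))).
Proof.
move=> H Hl H0 Hs.
have [dl Hdl] := ptime_size Hl; have [d0 Hd0] := ptime_size H0.
apply: (@ptime_foldl _ _ _ _ _ _ _ _ _
  (fun s => (s + 2) ^ d0 + (s + 2) ^ dl * (s + (s + 2) ^ dl + 2) ^ d)) => //.
  by polybound.
move=> x k _; apply: leq_trans (foldl_additive_growth _ _ (H x)) _.
have le := leq_trans (tree_size_take _ k _) (Hdl x).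
apply: leq_add => //; apply: leq_mul => //; apply: leq_exp2rW.
by rewrite leq_add2r leq_add2l.
Qed.

End TypedCombinators.

Section Lists.
Variables (X : Type) (e : X -> tree).
Variables (A B : X -> Type).
Variables (cA : forall x, A x -> tree) (cB : forall x, B x -> tree).

Lemma ptime_rev (l : forall x, seq (A x)) :
  ptime e (fun x => tree_of_seq (@cA x) (l x)) ->
  ptime e (fun x => tree_of_seq (@cA x) (rev (l x))).
Proof.
move=> Hl.
apply: (@ptime_eq _ _ (fun x => tree_of_seq (@cA x)
   (foldl (fun s a => a :: s) [::] (l x)))).
  move=> x; congr tree_of_seq; rewrite /rev.
  by elim: (l x) [::] => //= a s IH z; rewrite IH.
apply: (@ptime_foldl_additive _ _ _ _ _ (fun x => tree_of_seq (@cA x)) 1 _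
  (fun=> [::]) (fun x s a => a :: s)) => //.
- by move=> x s t /=; lia.
- exact: ptime_nil.
- apply: ptime_node; first exact: ptime_fst (ptime_snd (ptime_id _)).
  exact: ptime_snd (ptime_snd (ptime_id _)).
Qed.

Lemma ptime_foldr_additive d (l : forall x, seq (A x)) (s0 : forall x, B x)
    (step : forall x, A x -> B x -> B x) :
  (forall x s t, tree_size (cB (step x t s)) <=
     tree_size (cB s) + (tree_size (e x) + tree_size (cA t) + 2) ^ d) ->
  ptime e (fun x => tree_of_seq (@cA x) (l x)) ->
  ptime e (fun x => cB (s0 x)) ->
  ptime (fun p : {x : X & (A x * B x)%type} =>
           Node (e (tag p)) (Node (cA (tagged p).1) (cB (tagged p).2)))
        (fun p => cB (step _ (tagged p).1 (tagged p).2)) ->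
  ptime e (fun x => cB (foldr (step x) (s0 x) (l x))).
Proof.
move=> H Hl H0 Hs.
apply: (@ptime_eq _ _ (fun x => cB
   (foldl (fun s a => step x a s) (s0 x) (rev (l x))))).
  by move=> x; rewrite foldl_rev.
apply: (ptime_foldl_additive (step := fun x s a => step x a s)) => //.
exact: ptime_rev.
Qed.

End Lists.

Section MapFilter.
Variables (X : Type) (e : X -> tree).
Variables (A B : X -> Type).
Variables (cA : forall x, A x -> tree) (cB : forall x, B x -> tree).

Lemma ptime_map (l : forall x, seq (A x)) (f : forall x, A x -> B x) :
  ptime e (fun x => tree_of_seq (@cA x) (l x)) ->
  ptime (fun p : {x : X & A x} => Node (e (tag p)) (cA (tagged p)))
        (fun p => cB (f _ (tagged p))) ->
  ptime e (fun x => tree_of_seq (@cB x) [seq f x a | a <- l x]).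
Proof.
move=> Hl Hf; have [d Hd] := ptime_size Hf.
apply: (@ptime_eq _ _ (fun x => tree_of_seq (@cB x)
   (foldr (fun a s => f x a :: s) [::] (l x)))).
  by move=> x; congr tree_of_seq; elim: (l x) => //= a s ->.
have [d' Hd'] : polybounded (fun s => (s + 1 + 2) ^ d + 1) by polybound.
apply: (@ptime_foldr_additive _ _ _ _ _ (fun x => tree_of_seq (@cB x)) d' _
  (fun=> [::]) (fun x a s => f x a :: s)) => //.
- move=> x s t /=; have := Hd (existT _ x t); have := Hd' (tree_size (e x) + tree_size (cA t)).
  by rewrite /= addn1; lia.
- exact: ptime_leaf.
- apply: ptime_node; last exact: ptime_snd (ptime_snd (ptime_id _)).
  apply: (@ptime_comp _ _ (fun p : {x : X & (A x * seq (B x))%type} =>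
    Node (e (tag p)) (cA (tagged p).1))).
    apply: ptime_node; first exact: ptime_fst (ptime_id _).
    exact: ptime_fst (ptime_snd (ptime_id _)).
  exact: (ptime_reindex
    (fun p : {x : X & (A x * seq (B x))%type} => existT _ (tag p) (tagged p).1) Hf).
Qed.

Lemma ptime_filter (l : forall x, seq (A x)) (P : forall x, pred (A x)) :
  ptime e (fun x => tree_of_seq (@cA x) (l x)) ->
  ptime (fun p : {x : X & A x} => Node (e (tag p)) (cA (tagged p)))
        (fun p => tree_of_bool (P _ (tagged p))) ->
  ptime e (fun x => tree_of_seq (@cA x) [seq a <- l x | P x a]).
Proof.
move=> Hl HP.
apply: (@ptime_eq _ _ (fun x => tree_of_seq (@cA x)
   (foldr (fun a s => if P x a then a :: s else s) [::] (l x)))).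
  by move=> x; congr tree_of_seq; elim: (l x) => //= a s ->.
apply: (@ptime_foldr_additive _ _ _ _ _ (fun x => tree_of_seq (@cA x)) 1 _
  (fun=> [::]) (fun x a s => if P x a then a :: s else s)) => //.
- by move=> x s t /=; case: (P x t) => /=; lia.
- exact: ptime_leaf.
- apply: (@ptime_if _ _ _ (fun p : {x : X & (A x * seq (A x))%type} =>
    tree_of_seq (@cA (tag p)))
    (fun p => P (tag p) (tagged p).1) (fun p => (tagged p).1 :: (tagged p).2)
    (fun p => (tagged p).2)).
  + apply: (@ptime_comp _ _ (fun p : {x : X & (A x * seq (A x))%type} =>
      Node (e (tag p)) (cA (tagged p).1))).
      apply: ptime_node; first exact: ptime_fst (ptime_id _).
      exact: ptime_fst (ptime_snd (ptime_id _)).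
    exact: (ptime_reindex
      (fun p : {x : X & (A x * seq (A x))%type} => existT _ (tag p) (tagged p).1) HP).
  + apply: ptime_node; first exact: ptime_fst (ptime_snd (ptime_id _)).
    exact: ptime_snd (ptime_snd (ptime_id _)).
  + exact: ptime_snd (ptime_snd (ptime_id _)).
Qed.

End MapFilter.

Section Booleans.
Variables (X : Type) (e : X -> tree).
Variables (A B : X -> Type).
Variables (cA : forall x, A x -> tree) (cB : forall x, B x -> tree).

Lemma ptime_isnil (l : forall x, seq (A x)) :
  ptime e (fun x => tree_of_seq (@cA x) (l x)) ->
  ptime e (fun x => tree_of_bool (nilp (l x))).
Proof.
move=> Hl; have Ho := ptime_ohead Hl.
apply: (@ptime_eq _ _ (fun x => tree_of_bool
   (if ohead (l x) is Some a then false else true))).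
  by move=> x; case: (l x).
apply: (@ptime_option _ _ _ _ _ (fun=> tree_of_bool) _ (fun=> true)
   (fun _ _ => false) Ho).
  exact: ptime_true.
exact: ptime_false.
Qed.

Lemma ptime_not (b : X -> bool) :
  ptime e (fun x => tree_of_bool (b x)) -> ptime e (fun x => tree_of_bool (~~ b x)).
Proof.
move=> Hb; apply: (@ptime_if _ _ _ (fun=> tree_of_bool) b (fun=> false) (fun=> true)) => //.
  exact: ptime_false.
exact: ptime_true.
Qed.

Lemma ptime_and (b c : X -> bool) :
  ptime e (fun x => tree_of_bool (b x)) -> ptime e (fun x => tree_of_bool (c x)) ->
  ptime e (fun x => tree_of_bool (b x && c x)).
Proof.
move=> Hb Hc; apply: (@ptime_if _ _ _ (fun=> tree_of_bool) b c (fun=> false)) => //.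
exact: ptime_false.
Qed.

End Booleans.

Section MoreLists.
Variables (X : Type) (e : X -> tree).
Variables (A B : X -> Type).
Variables (cA : forall x, A x -> tree) (cB : forall x, B x -> tree).

Lemma ptime_has (l : forall x, seq (A x)) (P : forall x, pred (A x)) :
  ptime e (fun x => tree_of_seq (@cA x) (l x)) ->
  ptime (fun p : {x : X & A x} => Node (e (tag p)) (cA (tagged p)))
        (fun p => tree_of_bool (P _ (tagged p))) ->
  ptime e (fun x => tree_of_bool (has (P x) (l x))).
Proof.
move=> Hl HP.
apply: (@ptime_eq _ _ (fun x => tree_of_bool (~~ nilp [seq a <- l x | P x a]))).
  by move=> x; rewrite /nilp size_filter -lt0n -has_count.
exact: ptime_not (ptime_isnil (ptime_filter Hl HP)).
Qed.

Lemma ptime_all (l : forall x, seq (A x)) (P : forall x, pred (A x)) :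
  ptime e (fun x => tree_of_seq (@cA x) (l x)) ->
  ptime (fun p : {x : X & A x} => Node (e (tag p)) (cA (tagged p)))
        (fun p => tree_of_bool (P _ (tagged p))) ->
  ptime e (fun x => tree_of_bool (all (P x) (l x))).
Proof.
move=> Hl HP.
apply: (@ptime_eq _ _ (fun x => tree_of_bool (~~ has (fun a => ~~ P x a) (l x)))).
  by move=> x; rewrite -all_predC; congr tree_of_bool; apply: eq_all => a /=; rewrite negbK.
by apply: ptime_not; apply: ptime_has Hl _; apply: ptime_not.
Qed.

Lemma ptime_cat (l1 l2 : forall x, seq (A x)) :
  ptime e (fun x => tree_of_seq (@cA x) (l1 x)) ->
  ptime e (fun x => tree_of_seq (@cA x) (l2 x)) ->
  ptime e (fun x => tree_of_seq (@cA x) (l1 x ++ l2 x)).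
Proof.
move=> H1 H2.
apply: (@ptime_eq _ _ (fun x => tree_of_seq (@cA x) (foldr cons (l2 x) (l1 x)))).
  by move=> x; congr tree_of_seq; elim: (l1 x) => //= a s ->.
apply: (@ptime_foldr_additive _ _ _ _ _ (fun x => tree_of_seq (@cA x)) 1 _
  _ (fun x => cons)) => //.
- by move=> x s t /=; lia.
- exact: ptime_snd (ptime_id _).
Qed.

End MoreLists.

Lemma ptime_flatten X (e : X -> tree) (A : X -> Type)
    (cA : forall x, A x -> tree) (l : forall x, seq (seq (A x))) :
  ptime e (fun x => tree_of_seq (tree_of_seq (@cA x)) (l x)) ->
  ptime e (fun x => tree_of_seq (@cA x) (flatten (l x))).
Proof.
move=> Hl.
apply: (@ptime_foldr_additive _ _ _ _ (fun x => tree_of_seq (@cA x))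
  (fun x => tree_of_seq (@cA x)) 1 _ (fun=> [::]) (fun x => cat)) => //.
- by move=> x s t /=; elim: t => [|a t IH] /=; lia.
- exact: ptime_leaf.
apply: ptime_cat; first exact: ptime_fst (ptime_snd (ptime_id _)).
exact: ptime_snd (ptime_snd (ptime_id _)).
Qed.

(** * Equality of codes *)

Fixpoint tree_eqb (s t : tree) : bool :=
  match s, t with
  | Leaf, Leaf => true
  | Node a b, Node c d => tree_eqb a c && tree_eqb b d
  | _, _ => false
  end.

Lemma tree_eqbP s t : reflect (s = t) (tree_eqb s t).
Proof.
apply: (iffP idP) => [|<-]; last by elim: s => //= a -> b ->.
by elim: s t => [|a IHa b IHb] [|c d] //= /andP[/IHa-> /IHb->].
Qed.

(** Recursion into both subtrees is not a loop over a list, so this program is written by hand. Each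
    call compares one pair of nodes, hence the cost is linear in the first tree. *)
Lemma ptime_tree_eqb X (e f g : X -> tree) : ptime e f -> ptime e g ->
  ptime e (fun x => tree_of_bool (tree_eqb (f x) (g x))).
Proof.
move=> Hf Hg; apply: ptime_comp (ptime_node Hf Hg) _ => k.
(* [true] is coded by a node, so the case on the first comparison pushes two more entries: in the
   last call [EVar 5] and [EVar 3] are the right subtrees. *)
pose body := ECase (EVar 0) (ECase (EVar 1) (ENode ELeaf ELeaf) ELeaf)
  (ECase (EVar 3) ELeaf (ECase (ECall k [:: EVar 2; EVar 0]) ELeaf
     (ECall k [:: EVar 5; EVar 3]))).
apply: (@ptime_weaken _ _ _ _ (fun s => 20 * s + 20) [:: body]
  (ECase (EVar 0) ELeaf (ECall k [:: EVar 0; EVar 1]))).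
  by polybound.
move=> p0 r x sz /=; set P := p0 ++ _.
have bodyE : nth ELeaf P k = body by rewrite /P nth_cat -sz ltnn subnn.
have evals2 env i j : evals P env [:: EVar i; EVar j]
    [:: nth Leaf env i; nth Leaf env j] 2.
  apply: (@evals_cons _ _ _ _ _ _ 1 1); first exact: eval_var.
  by apply: (@evals_cons _ _ _ _ _ _ 1 0); [exact: eval_var | exact: evals_nil].
have cost s t : exists2 n, eval P [:: s; t] body (tree_of_bool (tree_eqb s t)) n &
    n <= 20 * tree_size s.
  elim: s t => [|a IHa b IHb] [|c d] /=.
  - exists (1 + (1 + (1 + 1).+1).+1).+1 => //.
    apply: eval_case_leaf; first exact: eval_var.
    apply: eval_case_leaf; first exact: eval_var.
    by apply: eval_node; exact: eval_leaf.
  - exists (1 + (1 + 1).+1).+1 => //.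
    apply: eval_case_leaf; first exact: eval_var.
    apply: eval_case_node; first exact: eval_var.
    exact: eval_leaf.
  - exists (1 + (1 + 1).+1).+1; last by lia.
    apply: eval_case_node; first exact: eval_var.
    apply: eval_case_leaf; first exact: eval_var.
    exact: eval_leaf.
  have [n1 ev1 le1] := IHa c; have [n2 ev2 le2] := IHb d.
  have call1 : eval P [:: c; d; a; b; Node a b; Node c d]
      (ECall k [:: EVar 2; EVar 0]) (tree_of_bool (tree_eqb a c)) (2 + n1).+1.
    by apply: (eval_call (evals2 _ 2 0)); rewrite bodyE.
  case: (tree_eqb a c) call1 => call1 /=; last first.
    exists (1 + (1 + ((2 + n1).+1 + 1).+1).+1).+1; last by lia.
    apply: eval_case_node; first exact: eval_var.
    apply: eval_case_node; first exact: eval_var.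
    by apply: eval_case_leaf call1 _; exact: eval_leaf.
  exists (1 + (1 + ((2 + n1).+1 + (2 + n2).+1).+1).+1).+1; last by lia.
  apply: eval_case_node; first exact: eval_var.
  apply: eval_case_node; first exact: eval_var.
  apply: eval_case_node call1 _.
  by apply: (eval_call (evals2 _ 5 3)); rewrite bodyE.
have [n ev le] := cost (f x) (g x).
exists (1 + (2 + n).+1).+1; last by case: (tree_eqb _ _) => /=; lia.
apply: eval_case_node; first exact: eval_var.
by apply: (eval_call (evals2 _ 0 1)); rewrite bodyE.
Qed.

(** Injectivity of the codes lets a program that sees only trees decide equality of names. *)
Lemma ptime_eqop X (e : X -> tree) (A : X -> eqType) (cA : forall x, A x -> tree)
    (a b : forall x, A x) :
  (forall x, injective (cA x)) ->
  ptime e (fun x => cA x (a x)) -> ptime e (fun x => cA x (b x)) ->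
  ptime e (fun x => tree_of_bool (a x == b x)).
Proof.
move=> inj Ha Hb; apply: ptime_eq (ptime_tree_eqb Ha Hb) => x.
by congr tree_of_bool; apply/tree_eqbP/eqP => [/inj|->].
Qed.

Lemma tree_of_option_inj (A : Type) (c : A -> tree) :
  injective c -> injective (tree_of_option c).
Proof. by move=> inj [a|] [b|] //= [/inj->]. Qed.

Lemma tree_of_pair_inj (A B : Type) (cA : A -> tree) (cB : B -> tree) :
  injective cA -> injective cB -> injective (tree_of_pair cA cB).
Proof. by move=> iA iB [a b] [c d] [/iA /= -> /iB /= ->]. Qed.

Lemma tree_of_seq_inj (A : Type) (c : A -> tree) :
  injective c -> injective (tree_of_seq c).
Proof. by move=> inj; elim=> [|a s IH] [|b t] //= [/inj-> /IH->]. Qed.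

(** * The algorithm *)

Section Algorithm.
Variables V E : choiceType.

Notation literal := (V * E)%type.
Notation entry := (seq literal * option V)%type.
Notation state := (seq literal * seq entry)%type.

(** The first pair for [v] counts, so a change put in front of the list overrides earlier values,
    and the log of changes doubles as the assignment. *)
Definition lookup (h : seq literal) (v : V) : option E :=
  ohead [seq y.2 | y <- h & y.1 == v].

(** Satisfaction at the variable [v], which is the edge relation of B_phi(F), as opposed to
    satisfaction of the clause. *)
Definition satisfies (h : seq literal) (v : V) (c : seq literal) : bool :=
  has (fun y => (y.1 == v) &&
    (if lookup h v is Some a then a != y.2 else false)) c.

Definition values (ds : seq (V * seq E)) (v : V) : seq E :=
  flatten [seq d.2 | d <- ds & d.1 == v].

Definition matched (M : seq entry) (v : V) : seq (seq literal) :=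
  [seq x.1 | x <- M & x.2 == Some v].

(** The |D_v| - 1 copies of a variable node are interchangeable. The matching is therefore stored as
    a map from listed clauses to variables with this load bound; copies are numbered only for the
    comparison with the graph. *)
Definition has_room ds (M : seq entry) (v : V) : bool :=
  size (matched M v) < (size (values ds v)).-1.

(** A clause with a literal on [v] is satisfied at [v] by the value [a] exactly if it lacks the
    literal [(v, a)]. *)
Definition fresh ds (M : seq entry) (v : V) (c : seq literal) : option E :=
  ohead [seq a <- values ds v | all (fun c' => (v, a) \notin c') (c :: matched M v)].

(* Equal to [rem x M] up to order, but written with filters only. *)
Definition remove1 (x : entry) (M : seq entry) : seq entry :=
  [seq y <- M | y != x] ++ behead [seq y <- M | y == x].

Definition reassign (M : seq entry) (x : entry) (v : V) : seq entry :=
  (x.1, Some v) :: remove1 x M.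

Definition candidates (M : seq entry) : seq (V * entry) :=
  flatten [seq [seq (y.1, x) | y <- x.1] | x <- M].

(* In an entry [(v, x)] of a search list, [x] is the listed clause, with its
   match, through which [v] was reached; the latest entry comes first. *)
Definition discover (L : seq (V * entry)) (z : V * entry) : seq (V * entry) :=
  if (z.1 \notin [seq y.1 | y <- L]) &&
     (if z.2.2 is Some u then u \in [seq y.1 | y <- L] else true)
  then z :: L else L.

(** [ds] acts as a counter: a pass over all candidates that changes anything reaches a new variable,
    so one pass per variable attains the fixed point. *)
Definition search (ds : seq (V * seq E)) (M : seq entry) : seq (V * entry) :=
  foldl (fun L _ => foldl discover L (candidates M)) [::] ds.

Definition waiting h (M : seq entry) (v : V) : option entry :=
  ohead [seq y <- M | (y.2 == None) && satisfies h v y.1].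

(* [s.1] lists the changes made so far, the latest first, so that the current
   assignment is obtained by lookup in [s.1 ++ ps]. *)
Definition adjust ds ps (s : state) (v : V) (c : seq literal) : seq literal :=
  if satisfies (s.1 ++ ps) v c then s.1 else
  if fresh ds s.2 v c is Some a then (v, a) :: s.1 else s.1.

(** The first component is the variable whose free place is to be filled, [None] once the walk has
    ended. Entries for other variables leave the state alone. *)
Definition visit ds ps (st : option V * state) (z : V * entry) :
    option V * state :=
  if st.1 == Some z.1 then
    if waiting (st.2.1 ++ ps) st.2.2 z.1 is Some y
    then (None, (st.2.1, reassign st.2.2 y z.1))
    else (z.2.2, (adjust ds ps st.2 z.1 z.2.1, reassign st.2.2 z.2 z.1))
  else st.

Definition target ds (M : seq entry) : option V :=
  ohead [seq v <- [seq y.1 | y <- search ds M] | has_room ds M v].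

Definition phase ds ps (s : state) : state :=
  (foldl (visit ds ps) (target ds s.2, s) (search ds s.2)).2.

Definition extend_total ps (o : seq literal) (d : V * seq E) : seq literal :=
  if lookup (o ++ ps) d.1 is Some _ then o else
  if ohead d.2 is Some a then (d.1, a) :: o else o.

Definition initial (ds : seq (V * seq E)) (cs : seq (seq literal)) ps : state :=
  (foldl (extend_total ps) [::] ds, [seq (c, None) | c <- cs]).

Definition run (ds : seq (V * seq E)) (cs : seq (seq literal)) ps : state :=
  foldl (fun s _ => phase ds ps s) (initial ds cs ps) cs.

Definition changes ds cs ps : seq literal := rev (run ds cs ps).1.

End Algorithm.

Lemma perm_remove1 (V E : choiceType) (x : seq (V * E) * option V) M :
  x \in M -> perm_eq (x :: remove1 x M) M.
Proof.
move=> xM; rewrite /remove1.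
have FE : [seq y <- M | y == x] = x :: behead [seq y <- M | y == x].
  have : x \in [seq y <- M | y == x] by rewrite mem_filter eqxx.
  have : all (fun y => y == x) [seq y <- M | y == x] by apply: filter_all.
  by case: (filter _ _) => //= a s /andP[/eqP-> _].
by rewrite -cat1s perm_catCA cat1s -FE perm_catC perm_filterC.
Qed.

Lemma ohead_filter_mem (A : eqType) (P : pred A) s a :
  ohead [seq x <- s | P x] = Some a -> P a && (a \in s).
Proof.
rewrite -mem_filter; case: (filter _ _) => //= b t [->].
by rewrite mem_head.
Qed.

(** * Conservativity *)

Lemma ohead_filter_none (A : eqType) (P : pred A) s a :
  ohead [seq x <- s | P x] = None -> a \in s -> ~~ P a.
Proof.
case E: (filter _ _) => //= _ As; apply/negP => Pa.
have : a \in [seq x <- s | P x] by rewrite mem_filter Pa.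
by rewrite E.
Qed.

Lemma conservative_seq_rcons (V E : choiceType) (D : V -> {fset E}) F phi s x :
  conservative_seq D F phi s -> conservative D F (foldl change phi s) x ->
  conservative_seq D F phi (rcons s x).
Proof. by elim: s phi => [|y s IH] phi //= [cy cs] cx; split=> //; apply: IH. Qed.

Section Correctness.
Variables (V E : choiceType) (D : V -> {fset E}) (F : {mset {fset V * E}}%mset).
Variable phi0 : {fmap V -> E}.
Hypothesis D_neq0 : forall v, D v != fset0.
Hypothesis F_clauses : multi_clause_set D F.
Variables (ds : seq (V * seq E)) (cs : seq (seq (V * E))) (ps : seq (V * E)).
Hypothesis ds_lists : lists_domains D F ds.
Hypothesis cs_lists : lists_clauses F cs.
Hypothesis ps_lists : lists_assignment phi0 ps.

Lemma mem_domains v : (v \in [seq d.1 | d <- ds]) = (v \in cls_var F).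
Proof. by have [/perm_mem/(_ v)] := ds_lists. Qed.

Lemma uniq_domains : uniq [seq d.1 | d <- ds].
Proof. by have [/perm_uniq->] := ds_lists; rewrite fset_uniq. Qed.

Lemma values_domain v : v \in cls_var F -> perm_eq (values ds v) (enum_fset (D v)).
Proof.
rewrite -mem_domains => /mapP[d dd ->].
suff -> : values ds d.1 = d.2 by have [_] := ds_lists; apply.
have := uniq_domains; rewrite /values; elim: (ds) dd => //= b s IH.
rewrite inE => /orP[/eqP-> /andP[nb _]|ds_ /andP[nb us]].
  rewrite eqxx /= (_ : [seq _ <- s | _] = [::]) /= ?cats0 //.
  apply/eqP; rewrite -[_ == _]negbK -has_filter; apply: contra nb => /hasP[y ys /eqP<-].
  exact: map_f.
by rewrite ifN ?IH //; apply: contraNneq nb => ->; apply: map_f.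
Qed.

Lemma size_values v : v \in cls_var F -> size (values ds v) = #|` D v|.
Proof. by move=> /values_domain/perm_size ->. Qed.

Lemma mem_clauses c : c \in cs -> 0 < F [fset x in c]%fset.
Proof.
by move=> cc; have [_ <-] := cs_lists; rewrite -has_count has_pred1; apply/mapP; exists c.
Qed.

Lemma clause_listed C : 0 < F C -> exists2 c, c \in cs & C = [fset x in c]%fset.
Proof.
have [_ <-] := cs_lists; rewrite -has_count has_pred1 => /mapP[c cc ->]; by exists c.
Qed.

Lemma clause_literal c x : c \in cs -> x \in c ->
  x.2 \in D x.1 /\ x.1 \in cls_var F.
Proof.
move=> /mem_clauses Fc xc; have [/(_ x) H _] := F_clauses Fc.
have xC : x \in [fset x in c]%fset by rewrite inE.
split; first exact: H.
apply/bigfcupP; exists [fset x in c]%fset; last by apply/imfsetP; exists x.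
by rewrite andbT mem_finsupp -lt0n.
Qed.

Lemma clause_functional c x y : c \in cs -> x \in c -> y \in c -> x.1 = y.1 -> x = y.
Proof.
by move=> /mem_clauses Fc xc yc; have [_] := F_clauses Fc; apply; rewrite inE.
Qed.

Definition current (o : seq (V * E)) := foldl change phi0 (rev o).

Lemma current_cons x o : current (x :: o) = change (current o) x.
Proof. by rewrite /current rev_cons foldl_rcons. Qed.

Lemma lookup_cons (x : V * E) h v :
  lookup (x :: h) v = if x.1 == v then Some x.2 else lookup h v.
Proof. by rewrite /lookup /=; case: ifP. Qed.

Lemma lookup_current o v : lookup (o ++ ps) v = ((current o).[? v])%fmap.
Proof.
elim: o => [|x o IH] /=.
  have [_ H] := ps_lists; rewrite /current /=.
  case El: (lookup ps v) => [a|].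
    symmetry; apply/H; move: El; rewrite /lookup.
    case Es: (filter _ _) => [|y s] //= [<-].
    have : y \in [seq y <- ps | y.1 == v] by rewrite Es mem_head.
    by rewrite mem_filter => /andP[/eqP<-]; case: y {Es}.
  case Ep: (phi0.[? v])%fmap => [a|] //; move/H: Ep El => vp.
  have : (v, a) \in [seq y <- ps | y.1 == v] by rewrite mem_filter eqxx.
  by rewrite /lookup; case: (filter _ _).
by rewrite lookup_cons current_cons /change fnd_set eq_sym; case: ifP.
Qed.

Lemma satisfiesP o v c :
  reflect (exists2 y, y \in c & y.1 = v /\ sat_literal (current o) y)
    (satisfies (o ++ ps) v c).
Proof.
apply: (iffP hasP) => [[y yc /andP[/eqP <-]]|[y yc [<- sy]]].
  by rewrite lookup_current => sy; exists y.
by exists y => //; rewrite eqxx lookup_current.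
Qed.

Lemma sat_literal_change o x y : sat_literal (current (x :: o)) y =
  if y.1 == x.1 then x.2 != y.2 else sat_literal (current o) y.
Proof. by rewrite current_cons /sat_literal /change fnd_set; case: ifP. Qed.

Notation entry := (seq (V * E) * option V)%type.
Implicit Types (M : seq entry) (o : seq (V * E)) (x y : entry).

(** Entries agree with [cs] up to order because [reassign] permutes them. [good_total] makes every
    change after the initial extension one of the second kind; [good_changes] is there for the size
    of the answer. *)
Record good o M : Prop := Good {
  good_conservative : conservative_seq D F phi0 (rev o);
  good_entries : perm_eq [seq x.1 | x <- M] cs;
  good_matched : forall x v, x \in M -> x.2 = Some v -> satisfies (o ++ ps) v x.1;
  good_load : forall v, size (matched M v) <= (size (values ds v)).-1;
  good_total : forall v, v \in cls_var F -> exists a, lookup (o ++ ps) v = Some a;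
  good_changes : forall l, l \in o -> l.1 \in cls_var F /\ l.2 \in D l.1 }.

Lemma good_entry o M x : good o M -> x \in M -> x.1 \in cs.
Proof. by move=> g xM; rewrite -(perm_mem (good_entries g)) map_f. Qed.

Lemma size_matched M v : size (matched M v) = count (fun x => x.2 == Some v) M.
Proof. by rewrite size_map size_filter. Qed.

Lemma size_matched_reassign M x v w : x \in M ->
  size (matched (reassign M x v) w) + (x.2 == Some w) = size (matched M w) + (v == w).
Proof.
move=> xM; rewrite !size_matched -(permP (perm_remove1 xM)) /=.
rewrite (inj_eq Some_inj); lia.
Qed.

Lemma perm_reassign M x v : x \in M ->
  perm_eq [seq y.1 | y <- reassign M x v] [seq y.1 | y <- M].
Proof. by move=> xM; rewrite (perm_map fst (perm_remove1 xM)). Qed.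

Lemma mem_reassign M x v y : x \in M -> y \in reassign M x v ->
  y = (x.1, Some v) \/ y \in M.
Proof.
move=> xM; rewrite inE => /orP[/eqP|yM]; [by left|right].
by rewrite -(perm_mem (perm_remove1 xM)) inE yM orbT.
Qed.

Definition match_count M := count (fun x => x.2 != None) M.

Lemma match_count_reassign M x v : x \in M ->
  match_count (reassign M x v) = match_count M + (x.2 == None).
Proof.
move=> xM; rewrite /match_count -(permP (perm_remove1 xM)) /=.
by case: eqP => /=; lia.
Qed.

Lemma good_accept o M v y : good o M -> has_room ds M v ->
  waiting (o ++ ps) M v = Some y ->
  [/\ good o (reassign M y v), y \in M & y.2 = None].
Proof.
move=> g room /ohead_filter_mem /andP[/andP[/eqP y2 sy] yM].
split=> //; case: g => g1 g2 g3 g4 g5 g6; split=> //.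
- by rewrite (permPl (perm_reassign _ yM)).
- move=> x w /(mem_reassign yM)[-> /= [<-] //|]; exact: g3.
- move=> w; have := size_matched_reassign v w yM; have := g4 w; move: room.
  rewrite /has_room; case: (eqVneq v w) => [->|_]; lia.
Qed.

(** Pigeonhole: a listed clause has at most one literal on [v] and so excludes at most one value,
    and room at [v] means that the clause of [x] and the matched ones together are fewer than the
    values. *)
Lemma fresh_exists o M x v : good o M -> has_room ds M v -> x \in M ->
  exists a, fresh ds M v x.1 = Some a.
Proof.
move=> g room xM; case Ef: (fresh _ _ _ _) => [a|]; first by exists a.
exfalso.
(* Outside [cls_var F] the list [values ds v] is empty and there is never room. *)
have v_cls : v \in cls_var F.
  rewrite -mem_domains; move: room; rewrite /has_room /values.
  case Es: (filter _ _) => [|d s] //= _.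
  have : d \in [seq d <- ds | d.1 == v] by rewrite Es mem_head.
  by rewrite mem_filter => /andP[/eqP<- dd]; apply: map_f.
pose bad (c : seq (V * E)) := [seq l.2 | l <- c & l.1 == v].
have sub : {subset values ds v <= flatten [seq bad c | c <- x.1 :: matched M v]}.
  move=> a av; have := ohead_filter_none Ef av.
  rewrite -has_predC => /hasP[c cm /= /negPn vac].
  apply/(@flattenP _ [seq bad c | c <- x.1 :: matched M v]).
  exists (bad c); first exact: map_f.
  by apply/mapP; exists (v, a) => //; rewrite mem_filter eqxx.
have szbad c : c \in cs -> size (bad c) <= 1.
  move=> cc; rewrite size_map; case Ec: [seq _ <- _ | _] => [|l [|l' s]] //.
  have uc : uniq c by have [/allP/(_ _ cc)] := cs_lists.
  have := filter_uniq (fun l => l.1 == v) uc; rewrite Ec /= inE negb_or.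
  have : {subset [:: l, l' & s] <= [seq l <- c | l.1 == v]} by rewrite Ec.
  move=> sub2; have := sub2 l (mem_head _ _); have := sub2 l'.
  rewrite !inE eqxx orbT !mem_filter => /(_ isT) /andP[/eqP v' c'] /andP[/eqP vl cl].
  by rewrite (clause_functional cc cl c') ?vl ?v' ?eqxx.
have uv : uniq (values ds v).
  by rewrite (perm_uniq (values_domain v_cls)) fset_uniq.
have := uniq_leq_size uv sub; rewrite [X in _ <= X]size_flatten /shape -map_comp /comp.
suff : sumn [seq size (bad c) | c <- x.1 :: matched M v] <= (size (matched M v)).+1.
  move: room; rewrite /has_room => r h1 h2.
  have h : size (values ds v) <= (size (matched M v)).+1 by exact: leq_trans h2 h1.
  lia.
have : all (fun c => c \in cs) (x.1 :: matched M v).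
  apply/allP => c; rewrite inE => /orP[/eqP->|/mapP[y]]; first exact: good_entry g xM.
  by rewrite mem_filter => /andP[_ yM] ->; apply: good_entry g yM.
rewrite -[(size _).+1]/(size (x.1 :: matched M v)).
elim: (x.1 :: _) => //= c s IH /andP[/szbad szc /IH]; lia.
Qed.

Lemma good_move o M x v :
  good o M -> has_room ds M v -> x \in M -> v \in [seq l.1 | l <- x.1] ->
  waiting (o ++ ps) M v = None ->
  good (adjust ds ps (o, M) v x.1) (reassign M x v).
Proof.
move=> g room xM /mapP[l lx vl] nowait.
have load w : size (matched (reassign M x v) w) <= (size (values ds w)).-1.
  have := size_matched_reassign v w xM; have := good_load g w; move: room.
  rewrite /has_room; case: (eqVneq v w) => [->|_]; lia.
have perm := perm_trans (perm_reassign v xM) (good_entries g).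
rewrite /adjust /=; case: ifP => [sx|/negbT nsx].
  case: g => g1 g2 g3 g4 g5 g6; split=> //.
  by move=> y w /(mem_reassign xM)[-> /= [<-] //|]; exact: g3.
have [a Ea] := fresh_exists g room xM; rewrite Ea.
have /andP[/andP[ax /allP am] av] := ohead_filter_mem Ea.
have xcs := good_entry g xM.
have v_cls : v \in cls_var F by rewrite vl; have [] := clause_literal xcs lx.
have aD : a \in D v by rewrite -(perm_mem (values_domain v_cls)).
have sat_new c : (v, a) \notin c -> (exists2 l, l \in c & l.1 = v) ->
    satisfies (((v, a) :: o) ++ ps) v c.
  move=> nac [l' l'c vl']; apply/satisfiesP; exists l' => //; split=> //.
  rewrite sat_literal_change vl' eqxx; apply: contraNneq nac => /= ->.
  by rewrite -vl'; case: (l') l'c.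
have sat_other w c : w != v -> satisfies (o ++ ps) w c ->
    satisfies (((v, a) :: o) ++ ps) w c.
  move=> wv /satisfiesP[l' l'c [l'w sl']]; apply/satisfiesP; exists l' => //.
  by split=> //; rewrite sat_literal_change l'w (negbTE wv).
have sat_matched y w : y \in M -> y.2 = Some w ->
    satisfies (((v, a) :: o) ++ ps) w y.1.
  move=> yM yw; have sy := good_matched g yM yw.
  (* A clause matched to [v] stays satisfied there by the choice of [a]; for one matched elsewhere
     the change does not touch the literal that counts. *)
  have [wv|] := eqVneq w v; last by move/sat_other; apply.
  rewrite wv in yw sy *; apply: sat_new.
    by apply: am; apply/mapP; exists y => //; rewrite mem_filter yw eqxx.
  by have /satisfiesP[l' l'c [l'v _]] := sy; exists l'.
split=> //.
- rewrite rev_cons; apply: conservative_seq_rcons (good_conservative g) _.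
  rewrite -/(current o) /conservative; right.
  have [b Eb] := good_total g v_cls; rewrite lookup_current in Eb.
  split=> //=.
  + by rewrite -fndSome Eb.
  (* A change must alter the value: had phi the value [a] at [v] already, the clause of [x] would be
     satisfied there, as it lacks [(v, a)]. *)
  + move=> Ea'; case/negP: nsx; apply/satisfiesP; exists l => //; split=> //.
    rewrite /sat_literal -vl Ea'; apply: contraNneq ax => ->; rewrite vl.
    by case: (l) lx.
  + move=> C FC /hasP[l' l'C sl'].
    (* Copies of [C] are satisfied together, so following any one listed copy suffices. *)
    have [c cc CE] := clause_listed FC.
    have l'c : l' \in c by move: l'C; rewrite CE inE.
    suff [w sw] : exists w, satisfies (((v, a) :: o) ++ ps) w c.
      have /satisfiesP[l2 l2c [_ sl2]] := sw.
      by apply/hasP; exists l2; [rewrite CE inE|rewrite -current_cons].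
    have [l'v|l'v] := eqVneq l'.1 v; last first.
      by exists l'.1; apply: sat_other l'v _; apply/satisfiesP; exists l'.
    move: cc; rewrite -(perm_mem (good_entries g)) => /mapP[y yM cy].
    case Ey: y.2 => [w|]; first by exists w; rewrite cy; apply: sat_matched.
    (* An unmatched clause satisfied at [v] would have been waiting. *)
    have := ohead_filter_none nowait yM; rewrite Ey eqxx /= => /negP[].
    by rewrite -cy; apply/satisfiesP; exists l'.
- move=> y w /(mem_reassign xM)[-> /= [<-]|]; last exact: sat_matched.
  by apply: sat_new ax _; exists l.
- move=> w /(good_total g)[b Eb]; rewrite cat_cons lookup_cons.
  by case: ifP => _; [exists a|exists b].
- by move=> l'; rewrite inE => /orP[/eqP->|/(good_changes g)].
Qed.

End Correctness.

(** * The search for reachable variables *)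

Section Search.
Variables V E : choiceType.
Notation entry := (seq (V * E) * option V)%type.
Implicit Types (M : seq entry) (L : seq (V * entry)) (z : V * entry).

Notation dom L := [seq z.1 | z <- L].

(** The search list as a forest of alternating paths rooted at unmatched clauses. Parents lie in the
    tail, so every suffix is again a chain; the induction along a path relies on this. *)
Fixpoint chain L : bool :=
  if L is z :: L' then
    [&& z.1 \notin dom L', z.1 \in [seq l.1 | l <- z.2.1],
        (if z.2.2 is Some u then u \in dom L' else true) & chain L']
  else true.

Lemma chain_uniq L : chain L -> uniq (dom L).
Proof. by elim: L => //= z L IH /and4P[-> _ _ /IH]. Qed.

Lemma chain_catr L1 L2 : chain (L1 ++ L2) -> chain L2.
Proof. by elim: L1 => //= z L1 IH /and4P[_ _ _ /IH]. Qed.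

(** The oldest entry has an empty tail, so its clause cannot be matched. *)
Lemma chain_source L : chain L -> L != [::] -> has (fun z => z.2.2 == None) L.
Proof.
elim: L => //= z [|z' L] IH /and4P[_ _]; first by case: z.2.2.
by move=> _ cL _; rewrite IH // orbT.
Qed.

Lemma candidatesP M z :
  reflect (z.2 \in M /\ z.1 \in [seq l.1 | l <- z.2.1]) (z \in candidates M).
Proof.
apply: (iffP flattenP) => [[t /mapP[x xM ->] /mapP[l lx ->]] /=|[zM /mapP[l lz zl]]].
  by split=> //; apply: map_f.
exists [seq (y.1, z.2) | y <- z.2.1]; first exact: map_f.
by apply/mapP; exists l; rewrite // -zl; case: (z).
Qed.

Lemma discover_cat L K : exists L', foldl (@discover V E) L K = L' ++ L.
Proof.
elim: K L => [|z K IH] L /=; first by exists [::].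
have [L' ->] := IH (discover L z); rewrite /discover; case: ifP => _.
  by exists (rcons L' z); rewrite cat_rcons.
by exists L'.
Qed.

Lemma discover_chain M L K : {subset K <= candidates M} ->
  chain L -> all (fun z => z.2 \in M) L ->
  chain (foldl (@discover V E) L K) /\
  all (fun z => z.2 \in M) (foldl (@discover V E) L K).
Proof.
elim: K L => //= z K IH L sub cL aL.
have /candidatesP[zM zl] := sub z (mem_head _ _).
have [cL' aL'] : chain (discover L z) /\ all (fun z => z.2 \in M) (discover L z).
  rewrite /discover; case: ifP => //= /andP[zL zu].
  by rewrite zL zl zu cL zM aL.
by apply: IH => // y yK; apply: sub; rewrite inE yK orbT.
Qed.

(** [discover] never drops entries, so a pass that returns the list it started from cannot have
    grown in between. *)
Lemma discover_fixed L K : foldl (@discover V E) L K = L ->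
  forall z, z \in K -> discover L z = L.
Proof.
elim: K L => //= y K IH L eL.
suff eq_y : discover L y = L.
  by move=> z; rewrite inE => /orP[/eqP-> //|]; apply: IH; rewrite -{2}eL eq_y.
move: eL; rewrite /discover; case: ifP => // _ eL.
have [L' e'] := discover_cat (y :: L) K; rewrite e' in eL.
by have := congr1 size eL; rewrite size_cat /=; lia.
Qed.

Definition closed_search M L := forall x, x \in M ->
  (if x.2 is Some u then u \in dom L else true) ->
  forall l, l \in x.1 -> l.1 \in dom L.

(** A chain has distinct variables, all from [ds], so its length is at most [size ds]. Every pass
    lengthens it or fixes it, and being fixed under a pass gives the closure property. *)
Lemma search_spec (ds : seq (V * seq E)) M :
  (forall x l, x \in M -> l \in x.1 -> l.1 \in [seq d.1 | d <- ds]) ->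
  [/\ chain (search ds M), all (fun z => z.2 \in M) (search ds M),
      size (search ds M) <= size ds & closed_search M (search ds M)].
Proof.
move=> vars; set pass := fun L => foldl (@discover V E) L (candidates M).
have searchE k (t : seq (V * seq E)) : size t = k ->
    foldl (fun L _ => pass L) [::] t = iter k pass [::].
  elim/last_ind: t k => [|t d IH] k; first by move=> <-.
  by rewrite size_rcons foldl_rcons => <- /=; rewrite (IH _ erefl).
have inv k : chain (iter k pass [::]) /\ all (fun z => z.2 \in M) (iter k pass [::]).
  elim: k => //= k [cL aL]; exact: (discover_chain (K := candidates M)).
have small L : chain L -> all (fun z => z.2 \in M) L -> size L <= size ds.
  move=> cL /allP aL; rewrite -(size_map fst L) -(size_map fst ds).
  apply: uniq_leq_size (chain_uniq cL) _ => v /mapP[z zL ->].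
  elim: L cL aL zL => //= y L IH /and4P[_ /mapP[l ly yl] _ cL] aL.
  rewrite inE => /orP[/eqP->|zL].
    by rewrite yl; apply: vars ly; apply: aL; rewrite mem_head.
  by apply: IH => // w wL; apply: aL; rewrite inE wL orbT.
have grow k : k <= size (iter k pass [::]) \/ pass (iter k pass [::]) = iter k pass [::].
  elim: k => [|k [IH|IH]]; [by left| |by right; rewrite /= IH].
  have [L' e'] := discover_cat (iter k pass [::]) (candidates M).
  rewrite /= {1 3}/pass e'; case: L' e' => [|z L'] e'; last first.
    by left; rewrite /= size_cat; lia.
  by right; rewrite /= {1}/pass e'.
rewrite /search -/pass (searchE (size ds)) //.
set L := iter _ _ _; have [cL aL] := inv (size ds).
split=> //; first exact: small.
(* Either a fixed point occurred already, or the list has its maximal length and another pass cannot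
   lengthen it. *)
have fixL : pass L = L.
  have [le|//] := grow (size ds).
  have [L' e'] := discover_cat L (candidates M).
  have [cL' aL'] := inv (size ds).+1; have := small _ cL' aL'.
  rewrite /= -/L /pass e' size_cat -/L => le'.
  by have -> : L' = [::]; first by apply/nilP; rewrite /nilp -/L in le le' *; lia.
move=> x xM xu l lx.
have := discover_fixed fixL (z := (l.1, x)).
rewrite /discover /= => /(_ _); case: ifP => [_ H|/negbT + _].
  have zK : (l.1, x) \in candidates M by apply/candidatesP; split=> //; apply: map_f.
  by have := congr1 size (H zK); rewrite /=; lia.
by rewrite xu andbT negbK.
Qed.

End Search.

Arguments match_count : simpl never.

(** * The walk back, one phase, all phases *)

Section Run.
Variables (V E : choiceType) (D : V -> {fset E}) (F : {mset {fset V * E}}%mset).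
Variable phi0 : {fmap V -> E}.
Hypothesis D_neq0 : forall v, D v != fset0.
Hypothesis F_clauses : multi_clause_set D F.
Variables (ds : seq (V * seq E)) (cs : seq (seq (V * E))) (ps : seq (V * E)).
Hypothesis ds_lists : lists_domains D F ds.
Hypothesis cs_lists : lists_clauses F cs.
Hypothesis ps_lists : lists_assignment phi0 ps.
Notation entry := (seq (V * E) * option V)%type.
Implicit Types (M : seq entry) (o : seq (V * E)) (x y : entry).
Notation dom L := [seq z.1 | z <- L].
Notation good := (good D F phi0 ds cs ps).

Lemma visit_none (s : seq (V * E) * seq entry) L :
  foldl (visit ds ps) (None, s) L = (None, s).
Proof. by elim: L. Qed.

Lemma visit_skip v (s : seq (V * E) * seq entry) L : v \notin dom L ->
  foldl (visit ds ps) (Some v, s) L = (Some v, s).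
Proof.
elim: L => //= z L IH; rewrite inE negb_or => /andP[vz /IH].
by rewrite /visit /= (inj_eq Some_inj) (negbTE vz).
Qed.

Lemma split_dom v (L : seq (V * entry)) : v \in dom L ->
  exists L1 x L2, L = L1 ++ (v, x) :: L2 /\ v \notin dom L1.
Proof.
elim: L => //= z L IH; rewrite inE.
have [->|vz] /= := eqVneq v z.1; first by exists [::], z.2, L; case: (z).
by move=> /IH[L1 [x [L2 [-> nv]]]]; exists (z :: L1), x, L2; rewrite /= inE negb_or vz.
Qed.

Lemma chain_parent (L : seq (V * entry)) z u :
  chain L -> z \in L -> z.2.2 = Some u -> u \in dom L.
Proof.
elim: L => //= y L IH /and4P[_ _ yu cL]; rewrite !inE => /orP[/eqP->|zL] zu.
  by rewrite zu in yu; rewrite yu orbT.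
by rewrite IH ?orbT.
Qed.

Lemma size_adjust (s : seq (V * E) * seq entry) v c :
  size (adjust ds ps s v c) <= (size s.1).+1.
Proof. by rewrite /adjust; case: ifP => // _; case: fresh. Qed.

(** Induction on the part of the list still to be traversed. When [x] leaves [u] for [v], the free
    place passes from [v] to [u], and the suffix starting at [u] meets the hypotheses again for the
    new matching. Each entry costs at most one change, which gives the length bound. *)
Lemma trace_good v x L o M :
  chain ((v, x) :: L) -> all (fun z => z.2 \in M) ((v, x) :: L) ->
  good o M -> has_room ds M v ->
  let r := (foldl (visit ds ps) (Some v, (o, M)) ((v, x) :: L)).2 in
  [/\ good r.1 r.2, match_count r.2 = (match_count M).+1 &
      size r.1 <= size o + (size L).+1].
Proof.
have [n] := ubnP (size L); elim: n v x L o M => // n IH v x L o M /ltnSE szL.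
move=> /= /and4P[vL vx xu cL] /andP[xM aL] g room.
rewrite [visit _ _ _ (v, x)]/visit /= eqxx.
case Ey: (waiting _ _ _) => [y|].
  have [g' yM y2] := good_accept g room Ey; rewrite visit_none /=.
  by rewrite match_count_reassign // y2 eqxx addn1; split=> //; lia.
have g' := good_move F_clauses ds_lists cs_lists ps_lists g room xM vx Ey.
have := size_adjust (o, M) v x.1 => /= sza.
case Ex: x.2 xu => [u|] xu; last first.
  by rewrite visit_none /= match_count_reassign // Ex eqxx addn1; split=> //; lia.
have [L1 [x' [L2 [eL uL1]]]] := split_dom xu; rewrite eL in szL vL cL aL *.
rewrite foldl_cat visit_skip //.
have cL2 := chain_catr cL; move: aL; rewrite all_cat => /andP[_ aL2].
have vu : v != u by apply: contraNneq vL => ->; rewrite map_cat mem_cat mem_head orbT.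
have uL2 : u \notin dom L2 by move: cL2 => /= /and4P[].
have [|||||g2 count2 size2] := IH u x' L2 (adjust ds ps (o, M) v x.1) (reassign M x v) => //.
- by move: szL; rewrite size_cat /=; lia.
(* Reassigning removes only [x]. If the suffix contained an entry for [x], whose match is [u], then
   [u] would be reached within [L2], against [uL2]. *)
- apply/allP => z zL2; have zM := allP aL2 z zL2.
  rewrite inE; apply/orP; right.
  move: zM; rewrite -(perm_mem (perm_remove1 xM)) inE => /orP[/eqP zx|//].
  case/negP: uL2; have zu : z.2.2 = Some u by rewrite zx.
  move: cL2 zL2; rewrite inE => /= /and4P[_ _ x'u cL2] /orP[/eqP ez|zL2].
    by move: x'u; rewrite -[x']/((u, x').2) -ez zu.
  exact: chain_parent cL2 zL2 zu.
- have := size_matched_reassign v u xM; have := good_load g u.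
  by rewrite /has_room Ex eqxx (negbTE vu); lia.
split=> //.
  by rewrite count2 match_count_reassign // Ex addn0.
by apply: leq_trans size2 _; rewrite size_cat /=; lia.
Qed.

Lemma good_vars o M x (l : V * E) : good o M -> x \in M -> l \in x.1 ->
  l.1 \in [seq d.1 | d <- ds].
Proof.
move=> g /(good_entry g) xcs lx; rewrite (mem_domains ds_lists).
by have [] := clause_literal F_clauses cs_lists xcs lx.
Qed.

Lemma phase_target_none s : target ds s.2 = None -> phase ds ps s = s.
Proof. by rewrite /phase => ->; rewrite visit_none. Qed.

Lemma phase_target_some o M v : good o M -> target ds M = Some v ->
  let r := phase ds ps (o, M) in
  [/\ good r.1 r.2, match_count r.2 = (match_count M).+1 &
      size r.1 <= size o + size ds].
Proof.
move=> g tv; have [cL aL szL _] := search_spec (fun x l => @good_vars o M x l g).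
have /andP[room vL] := ohead_filter_mem tv.
have [L1 [x [L2 [eL vL1]]]] := split_dom vL.
rewrite /phase /= tv eL foldl_cat visit_skip //.
rewrite eL in cL aL szL; move: aL; rewrite all_cat => /andP[_ aL].
have [] := trace_good (chain_catr cL) aL g room.
by move=> gr cr sr; split=> //; move: szL sr; rewrite size_cat /=; lia.
Qed.

(** Without unmatched clauses the search has no source and stays empty. *)
Lemma target_none_full o M : good o M -> size cs <= match_count M ->
  target ds M = None.
Proof.
move=> g full; have [cL aL _ _] := search_spec (fun x l => @good_vars o M x l g).
suff L0 : search ds M = [::] by rewrite /target L0.
apply/eqP/negPn/negP => /(chain_source cL) /hasP[z zL z2].
have zM := allP aL z zL.
have : count (fun x => x.2 != None) M = size M.
  have sM : size M = size cs by rewrite -(perm_size (good_entries g)) size_map.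
  by apply/eqP; rewrite eqn_leq count_size sM.
by move/eqP; rewrite -all_count => /allP/(_ _ zM); rewrite z2.
Qed.

Lemma good_initial : partial_assignment D phi0 ->
  let s := initial ds cs ps in good s.1 s.2 /\ size s.1 <= size ds.
Proof.
move=> Dphi /=; set M := [seq (c, None) | c <- cs].
have M2 x : x \in M -> x.2 = None by case/mapP => c _ ->.
have matchedM v : matched M v = [::].
  rewrite /matched (_ : [seq _ <- M | _] = [::]) //.
  by apply/eqP; rewrite -[_ == _]negbK -has_filter; apply/hasPn => x /M2 ->.
have [perm matched0] : perm_eq [seq x.1 | x <- M] cs /\
    forall v, size (matched M v) <= (size (values ds v)).-1.
  by split=> [|v]; [rewrite -map_comp map_id | rewrite matchedM].
suff H t : {subset t <= ds} -> let o := foldl (extend_total ps) [::] t in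
    [/\ conservative_seq D F phi0 (rev o),
        forall d, d \in t -> exists a, lookup (o ++ ps) d.1 = Some a,
        forall l, l \in o -> l.1 \in cls_var F /\ l.2 \in D l.1 &
        size o <= size t].
  have [//|o1 o2 o3 o4] := H ds; split=> //; split=> //.
    by move=> x v /M2 ->.
  move=> v; rewrite -(mem_domains ds_lists) => /mapP[d dd ->]; exact: o2.
elim/last_ind: t => [|t d IH] sub /=; first by split.
have [|o1 o2 o3 o4] := IH; first by move=> y yt; apply: sub; rewrite mem_rcons inE yt orbT.
have dd : d \in ds by apply: sub; rewrite mem_rcons mem_head.
rewrite foldl_rcons; set o := foldl _ _ t in o1 o2 o3 o4 *; rewrite size_rcons.
rewrite /extend_total; case El: (lookup _ _) => [b|].
  split=> //; last exact: leqW o4.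
  by move=> y; rewrite mem_rcons inE => /orP[/eqP->|/o2//]; exists b.
have d_cls : d.1 \in cls_var F by rewrite -(mem_domains ds_lists) map_f.
have permd : perm_eq d.2 (enum_fset (D d.1)) by have [_] := ds_lists; apply.
case Ed: (ohead d.2) => [a|]; last first.
  have /fset0Pn[a] := D_neq0 d.1; rewrite -[_ \in _]/(a \in enum_fset _) -(perm_mem permd).
  by case: (d.2) Ed.
have aD : a \in D d.1.
  rewrite -[_ \in _]/(a \in enum_fset _) -(perm_mem permd).
  by case: (d.2) Ed => //= b s [->]; rewrite mem_head.
split.
- rewrite rev_cons; apply: conservative_seq_rcons => //.
  rewrite -/(current phi0 o); left; split=> //=.
  by rewrite -fndSome -(lookup_current ps_lists) El.
- move=> y; rewrite mem_rcons inE => yt; rewrite cat_cons lookup_cons /=.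
  case: ifP => [_|/negP ny]; first by exists a.
  by case/orP: yt => [/eqP ey|/o2//]; rewrite ey in ny.
- by move=> l; rewrite inE => /orP[/eqP->|/o3//].
- exact: o4.
Qed.

(** The factor [k.+1] counts the initial extension and [k] phases, each with at most [size ds]
    changes. All prefixes are covered because the running time needs a bound on every intermediate
    state. *)
Lemma run_prefix k : partial_assignment D phi0 -> k <= size cs ->
  let s := foldl (fun s _ => phase ds ps s) (initial ds cs ps) (take k cs) in
  [/\ good s.1 s.2, size s.1 <= k.+1 * size ds &
      target ds s.2 = None \/ k <= match_count s.2].
Proof.
move=> Dphi; elim: k => [_|k IH lek].
  have [g sz] := good_initial Dphi; rewrite take0 /= in g sz *.
  by split=> //; [rewrite mul1n | right].
have [c0 _] : exists c : seq (V * E), True by exists [::].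
have [] := IH (ltnW lek); rewrite (take_nth c0 lek) foldl_rcons.
set s := foldl _ _ _ => g sz [no_target|le].
  by rewrite phase_target_none //; split=> //; [rewrite mulSn; lia|left].
case Et: (target ds s.2) => [v|].
  have [] := phase_target_some g Et; rewrite -surjective_pairing => g' c' sz'.
  by split=> //; [rewrite mulSn; lia | right; lia].
by rewrite phase_target_none //; split=> //; [rewrite mulSn; lia|left].
Qed.

Lemma run_good : partial_assignment D phi0 ->
  let s := run ds cs ps in good s.1 s.2 /\ target ds s.2 = None.
Proof.
move=> Dphi; have [] := run_prefix Dphi (leqnn _); rewrite take_size -/(run ds cs ps).
move=> g _ [t0|full]; split=> //; exact: target_none_full g full.
Qed.

End Run.

(** * Maximality *)

(** Occurrence numbers, counted from the right and starting at 1, turn a list with repetitions into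
    distinct nodes of the shape used in [clause_nodes] and [var_nodes]. *)
Fixpoint ranks (A : eqType) (s : seq A) : seq (A * nat) :=
  if s is x :: s' then (x, (count_mem x s').+1) :: ranks s' else [::].

Lemma mem_ranks (A : eqType) (s : seq A) z :
  (z \in ranks s) = (0 < z.2 <= count_mem z.1 s).
Proof.
case: z => y i; elim: s => [|x s IH] /=; first by rewrite in_nil; case: i.
rewrite inE IH /=; rewrite xpair_eqE eq_sym.
have [->|_] /= := eqVneq x y; last by rewrite add0n.
by rewrite add1n; lia.
Qed.

Lemma uniq_ranks (A : eqType) (s : seq A) : uniq (ranks s).
Proof. by elim: s => //= x s ->; rewrite mem_ranks /= ltnn. Qed.

Lemma unzip1_ranks (A : eqType) (s : seq A) : [seq z.1 | z <- ranks s] = s.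
Proof. by elim: s => //= x s ->. Qed.

Lemma size_ranks (A : eqType) (s : seq A) : size (ranks s) = size s.
Proof. by rewrite -{2}(unzip1_ranks s) size_map. Qed.

Lemma matching_number_le (L R : choiceType) (G H : bigraph L R) :
  (edges G `<=` edges H)%fset -> matching_number G <= matching_number H.
Proof.
move=> GH; apply/bigmax_leqP_seq => M; rewrite fpowersetE => MG /and3P[_ u1 u2].
apply: leq_bigmax_seq; first by rewrite fpowersetE (fsubset_trans MG).
by rewrite /is_matching (fsubset_trans MG GH) u1.
Qed.

Lemma matching_number_ge (L R : choiceType) (G : bigraph L R) (s : seq (L * R)) :
  {subset s <= edges G} -> uniq [seq x.1 | x <- s] -> uniq [seq x.2 | x <- s] ->
  size s <= matching_number G.
Proof.
move=> sG u1 u2; set M := [fset x in s]%fset.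
have Ms : perm_eq (enum_fset M) s.
  apply: uniq_perm; [exact: fset_uniq | exact: map_uniq u1 |].
  by move=> x; rewrite -[LHS]/(x \in M) inE.
have MG : (M `<=` edges G)%fset by apply/fsubsetP => x; rewrite inE; apply: sG.
rewrite -(perm_size Ms); apply: (leq_bigmax_seq M); first by rewrite fpowersetE.
by rewrite /is_matching MG (perm_uniq (perm_map _ Ms)) u1 (perm_uniq (perm_map _ Ms)).
Qed.

Lemma count_some (A V : eqType) (M : seq (A * option V)) (s : seq V) : uniq s ->
  sumn [seq count (fun x => x.2 == Some v) M | v <- s] =
  count (fun x => if x.2 is Some u then u \in s else false) M.
Proof.
elim: s => [|v s IH] /= => [_|/andP[vs /IH->]].
  apply/esym/eqP; rewrite -leqn0 leqNgt -has_count -all_predC.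
  by apply/allP => x _ /=; case: x.2.
elim: M {IH} => //= x M; case: x.2 => [u|] //=; rewrite inE (inj_eq Some_inj).
by have [->|_] /= := eqVneq u v; rewrite ?(negbTE vs); lia.
Qed.

Section Maximum.
Variables (V E : choiceType) (D : V -> {fset E}) (F : {mset {fset V * E}}%mset).
Variable phi0 : {fmap V -> E}.
Hypothesis F_clauses : multi_clause_set D F.
Variables (ds : seq (V * seq E)) (cs : seq (seq (V * E))) (ps : seq (V * E)).
Hypothesis ds_lists : lists_domains D F ds.
Hypothesis cs_lists : lists_clauses F cs.
Hypothesis ps_lists : lists_assignment phi0 ps.
Notation entry := (seq (V * E) * option V)%type.
Implicit Types (M : seq entry) (o : seq (V * E)) (x y : entry).
Notation dom L := [seq z.1 | z <- L].
Notation good := (good D F phi0 ds cs ps).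
Notation set_of c := [fset l in c]%fset.

Lemma clause_nodesP C i : reflect (0 < i <= F C) ((C, i) \in clause_nodes F).
Proof.
apply: (iffP (imfset2P _ _ _ _ _)) => [[C' _ [i' ii [-> ->]]]|/andP[i0 iF]].
  by have : i' \in iota 1 (F C') by []; rewrite mem_iota; lia.
exists C; first by rewrite [_ \in _]mem_finsupp -lt0n; lia.
by exists i => //; rewrite [_ \in _]mem_iota; lia.
Qed.

Lemma var_nodesP v j :
  reflect (v \in cls_var F /\ 0 < j <= #|` D v| - 1) ((v, j) \in var_nodes D F).
Proof.
apply: (iffP (imfset2P _ _ _ _ _)) => [[v' vF [j' jj [-> ->]]]|[vF /andP[j0 jD]]].
  by split=> //; have : j' \in iota 1 (#|` D v'| - 1) by []; rewrite mem_iota; lia.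
exists v => //; exists j => //; rewrite [_ \in _]mem_iota; lia.
Qed.

Lemma count_clauses C : count_mem C [seq set_of c | c <- cs] = F C.
Proof. by have [_] := cs_lists. Qed.

Definition matched_pairs M : seq ({fset V * E} * V) :=
  pmap (fun x => omap (pair (set_of x.1)) x.2) M.

Lemma size_matched_pairs M : size (matched_pairs M) = match_count M.
Proof.
rewrite size_pmap /match_count; apply: eq_count => x /=.
by case: x.2.
Qed.

(** Occurrences are numbered independently on the two sides. This makes the clause nodes pairwise
    distinct and likewise the copies of variables, so a map with bounded load becomes a matching. *)
Fixpoint ranked_edges (s : seq ({fset V * E} * V)) :
    seq ((({fset V * E} * nat)) * (V * nat)) :=
  if s is z :: s' then
    ((z.1, (count (fun t => t.1 == z.1) s').+1),
     (z.2, (count (fun t => t.2 == z.2) s').+1)) :: ranked_edges s'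
  else [::].

Lemma size_ranked_edges s : size (ranked_edges s) = size s.
Proof. by elim: s => //= z s ->. Qed.

Lemma ranked_edges1 s :
  [seq e.1 | e <- ranked_edges s] = ranks [seq z.1 | z <- s].
Proof. by elim: s => //= z s ->; rewrite count_map. Qed.

Lemma ranked_edges2 s :
  [seq e.2 | e <- ranked_edges s] = ranks [seq z.2 | z <- s].
Proof. by elim: s => //= z s ->; rewrite count_map. Qed.

Lemma mem_ranked_edges s e : e \in ranked_edges s -> (e.1.1, e.2.1) \in s.
Proof.
elim: s => //= z s IH; rewrite !inE => /orP[/eqP->|/IH ->]; last by rewrite orbT.
by case: z => *; rewrite eqxx.
Qed.

Lemma good_lower_bound o M : good o M ->
  match_count M <= matching_number (sat_graph D (current phi0 o) F).
Proof.
move=> g; rewrite -size_matched_pairs -size_ranked_edges.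
apply: matching_number_ge; last by rewrite ranked_edges2 uniq_ranks.
  move=> e ems; have := mem_ranked_edges ems.
  have e1 : e.1 \in ranks [seq z.1 | z <- matched_pairs M].
    by rewrite -ranked_edges1 map_f.
  have e2 : e.2 \in ranks [seq z.2 | z <- matched_pairs M].
    by rewrite -ranked_edges2 map_f.
  rewrite mem_pmap => /mapP[x xM]; case Ex: x.2 => [v|] //= [eC ev].
  have /(satisfiesP ps_lists)[l lx [lv sl]] := good_matched g xM Ex.
  have xcs := good_entry g xM.
  have v_cls : v \in cls_var F.
    by rewrite -lv; have [] := clause_literal F_clauses cs_lists xcs lx.
  rewrite !inE -!andbA; apply/and4P; split.
  (* The occurrence number stays within [F C] because the entries rearrange [cs], which lists [C]
     exactly [F C] times. *)
  - case: (e) e1 eC => -[C i] w /= e1 _; apply/clause_nodesP.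
    move: e1; rewrite mem_ranks /= => /andP[-> le]; apply: leq_trans le _.
    rewrite -count_clauses.
    rewrite -(permP (perm_map (fun c : seq (V * E) => set_of c) (good_entries g))).
    rewrite /matched_pairs; elim: (M) => //= y s IH.
    by case: y.2 => [u|] /=; rewrite ?leq_add2l //; apply: leq_trans IH (leq_addl _ _).
  (* On the variable side the number of the copy is limited by [good_load]. *)
  - case: (e) e2 ev => w [v' j] /= e2 ev; rewrite -ev in v_cls; apply/var_nodesP.
    split=> //; move: e2; rewrite mem_ranks /= => /andP[-> le].
    apply: leq_trans le _; rewrite subn1 -(size_values ds_lists v_cls).
    apply: leq_trans (good_load g v'); rewrite size_matched.
    rewrite /matched_pairs; elim: (M) => //= y s IH.
    by case: y.2 => [u|] /=; rewrite ?(inj_eq Some_inj) ?leq_add2l.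
  - by rewrite eC ev -lv; apply/imfsetP; exists l => //=; rewrite inE.
  - by apply/hasP; exists l; rewrite ?eC ?inE // ev lv eqxx.
by rewrite ranked_edges1 uniq_ranks.
Qed.

(** The vertex cover consists of the copies of the reached variables [S] and of the clauses with a
    variable outside [S]. Edges of [N] whose clause lies inside [S] are charged to copies, the
    others to clauses; the two totals are at most the numbers of clauses matched into [S] and
    outside [S]. *)
Lemma good_upper_bound o M : good o M -> target ds M = None ->
  matching_number (occ_graph D F) <= match_count M.
Proof.
move=> g no_target; apply/bigmax_leqP_seq => N _ /and3P[/fsubsetP NE u1 u2].
have [cL aL _ closedL] := search_spec (fun x l =>
  @good_vars _ _ _ _ _ F_clauses _ _ _ ds_lists cs_lists o M x l g).
set S := dom (search ds M) in closedL.
have uS : uniq S := chain_uniq cL.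
pose inside (C : {fset V * E}) := all (fun l => l.1 \in S) (enum_fset C).
pose P (e : ({fset V * E} * nat) * (V * nat)) := inside e.1.1.
have Nedge e : e \in enum_fset N -> [/\ e.1 \in clause_nodes F, e.2 \in var_nodes D F
    & e.2.1 \in clause_var e.1.1].
  by move=> /(NE e); rewrite !inE => /andP[/andP[-> ->] ->].
have sz1 : size [seq e <- enum_fset N | P e] <=
    count (fun x => if x.2 is Some u then u \in S else false) M.
  rewrite -count_some // -(size_map snd).
  pose R := flatten [seq [seq (v, j) | j <- iota 1 (size (values ds v)).-1] | v <- S].
  apply: (@leq_trans (size R)).
    apply: uniq_leq_size; first by apply: subseq_uniq u2; apply/map_subseq/filter_subseq.
    move=> n /mapP[e]; rewrite mem_filter => /andP[Pe /Nedge[_ e2 ev]] ->.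
    move: e2 ev; case: (e) Pe => -[C i] [v j] /= PC /var_nodesP[v_cls jv].
    case/imfsetP => l /= lC vl.
    apply/flattenP; exists [seq (v, j') | j' <- iota 1 (size (values ds v)).-1].
      by apply: map_f; rewrite vl; apply: (allP PC).
    apply/mapP; exists j => //; rewrite mem_iota (size_values ds_lists v_cls).
    lia.
  rewrite /R size_flatten /shape -map_comp.
  suff le_load s : {subset s <= S} ->
      sumn [seq size [seq (v, j) | j <- iota 1 (size (values ds v)).-1] | v <- s] <=
      sumn [seq count (fun x => x.2 == Some v) M | v <- s] by apply: le_load.
  elim: s => //= v s IH sub; rewrite size_map size_iota.
  apply: leq_add; last by apply: IH => w ws; apply: sub; rewrite inE ws orbT.
  (* No target means that every reached variable carries its full load. *)
  have := ohead_filter_none no_target (sub v (mem_head _ _)).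
  by rewrite /has_room -leqNgt size_matched.
have sz2 : size [seq e <- enum_fset N | predC P e] <=
    count (fun x => if x.2 is Some u then u \notin S else false) M.
  rewrite -(size_map fst).
  pose R := ranks [seq C <- [seq set_of x.1 | x <- M] | ~~ inside C].
  apply: (@leq_trans (size R)).
    apply: uniq_leq_size; first by apply: subseq_uniq u1; apply/map_subseq/filter_subseq.
    move=> n /mapP[e]; rewrite mem_filter => /andP[Pe /Nedge[e1 _ _]] ->.
    move: e1; case: (e) Pe => -[C i] [v j] /= PC /clause_nodesP iF.
    rewrite mem_ranks /= count_filter (eq_count (a2 := pred1 C)); last first.
      by move=> C' /=; case: eqP => [->|].
    have -> : [seq set_of x.1 | x <- M] = [seq set_of c | c <- [seq x.1 | x <- M]].
      by rewrite -map_comp.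
    rewrite (permP (perm_map (fun c : seq (V * E) => set_of c) (good_entries g))).
    by rewrite count_clauses.
  rewrite /R size_ranks size_filter count_map.
  (* By closure, a clause with a variable outside [S] is not reached; hence it is matched, and to a
     variable outside [S]. *)
  have : all (fun x => ~~ inside (set_of x.1) ==>
      (if x.2 is Some u then u \notin S else false)) M.
    apply/allP => x xM; apply/implyP; apply: contraR => xS; apply/allP => l.
    rewrite -[_ \in _]/(l \in set_of x.1) inE; apply: closedL => //.
    by case: x.2 xS => // u; rewrite negbK.
  elim: (M) => //= x s IH /andP[/implyP xx /IH]; apply: leq_add.
  by case: (inside _) xx => //= ->.
rewrite -[#|` N|]/(size (enum_fset N)) -(count_predC P) -!size_filter.
apply: leq_trans (leq_add sz1 sz2) _; rewrite /match_count.
elim: (M) => //= x s IH; apply: leq_trans (_ : _ <= (x.2 != None) +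
  (count (fun x => if x.2 is Some u then u \in S else false) s +
   count (fun x => if x.2 is Some u then u \notin S else false) s)) _.
  by case: x.2 => [u|] /=; [case: (u \in S) => /=; lia | lia].
by rewrite leq_add2l.
Qed.

Lemma good_maximum o M : good o M -> target ds M = None ->
  matching_maximum D F (current phi0 o).
Proof.
move=> g t0; apply/eqP; rewrite eqn_leq.
rewrite (leq_trans (good_upper_bound g t0) (good_lower_bound g)) andbT.
by apply: matching_number_le; apply/fsubsetP => e; rewrite !inE => /andP[->].
Qed.
End Maximum.

(** * Running time *)

Lemma ptime_dropl X (e f g : X -> tree) : ptime e g -> ptime (fun x => Node (e x) (f x)) g.
Proof. exact/ptime_comp/ptime_fst/ptime_id. Qed.

Lemma ptime_dropr X (e f g : X -> tree) : ptime f g -> ptime (fun x => Node (e x) (f x)) g.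
Proof. exact/ptime_comp/ptime_snd/ptime_id. Qed.

(** Locates a value in the packed input: the input itself, something already known to be computable
    from the outer input, or a component of the right or left half. *)
Ltac ptime_arg :=
  first [ exact: ptime_id
        | match goal with H : ptime _ _ |- _ => exact (ptime_reindex _ H) end
        | apply: ptime_dropr; ptime_arg
        | apply: ptime_dropl; ptime_arg ].

Lemma ptime_mem X (e : X -> tree) (A : X -> eqType) (cA : forall x, A x -> tree)
    (a : forall x, A x) (s : forall x, seq (A x)) :
  (forall x, injective (cA x)) ->
  ptime e (fun x => cA x (a x)) ->
  ptime e (fun x => tree_of_seq (cA x) (s x)) ->
  ptime e (fun x => tree_of_bool (a x \in s x)).
Proof.
move=> inj Ha Hs.
apply: (@ptime_eq _ _ (fun x => tree_of_bool (has (fun b => b == a x) (s x)))).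
  by move=> x; congr tree_of_bool; rewrite -has_pred1.
apply: (ptime_has (P := fun x b => b == a x)) Hs _.
apply: (ptime_eqop (cA := fun p : {x : X & A x} => cA (tag p))) => //.
  ptime_arg.
ptime_arg.
Qed.

(* The program must not depend on the types [V] and [E]; what follows is
   therefore about families indexed by the inputs [x : X], with names [N x]. *)
Record naming := Naming {
  variable : choiceType;
  value : choiceType;
  code_var : variable -> tree;
  code_val : value -> tree;
  code_var_inj : injective code_var;
  code_val_inj : injective code_val }.

Notation literal N := (variable N * value N)%type.
Notation entry N := (seq (literal N) * option (variable N))%type.
Notation state N := (seq (literal N) * seq (entry N))%type.

Definition code_lit (N : naming) : literal N -> tree :=
  tree_of_literal (@code_var N) (@code_val N).
Definition code_clause (N : naming) : seq (literal N) -> tree := tree_of_seq (@code_lit N).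
Definition code_entry (N : naming) : entry N -> tree :=
  tree_of_pair (@code_clause N) (tree_of_option (@code_var N)).
Definition code_state (N : naming) : state N -> tree :=
  tree_of_pair (tree_of_seq (@code_lit N)) (tree_of_seq (@code_entry N)).
Definition code_domains (N : naming) : seq (variable N * seq (value N)) -> tree :=
  tree_of_seq (tree_of_domain (@code_var N) (@code_val N)).

Definition code_visit (N : naming) : option (variable N) * state N -> tree :=
  tree_of_pair (tree_of_option (@code_var N)) (@code_state N).
Definition code_find (N : naming) : variable N * entry N -> tree :=
  tree_of_pair (@code_var N) (@code_entry N).

Section Projections.
Variables (X : Type) (N : X -> naming) (e : X -> tree).

Lemma ptime_lit1 (l : forall x, literal (N x)) :
  ptime e (fun x => code_lit (l x)) -> ptime e (fun x => code_var (l x).1).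
Proof. exact: ptime_fst. Qed.

Lemma ptime_lit2 (l : forall x, literal (N x)) :
  ptime e (fun x => code_lit (l x)) -> ptime e (fun x => code_val (l x).2).
Proof. exact: ptime_snd. Qed.

Lemma ptime_entry1 (l : forall x, entry (N x)) :
  ptime e (fun x => code_entry (l x)) -> ptime e (fun x => code_clause (l x).1).
Proof. exact: ptime_fst. Qed.

Lemma ptime_entry2 (l : forall x, entry (N x)) :
  ptime e (fun x => code_entry (l x)) ->
  ptime e (fun x => tree_of_option (@code_var _) (l x).2).
Proof. exact: ptime_snd. Qed.

Lemma ptime_state1 (l : forall x, state (N x)) :
  ptime e (fun x => code_state (l x)) -> ptime e (fun x => code_clause (l x).1).
Proof. exact: ptime_fst. Qed.

Lemma ptime_state2 (l : forall x, state (N x)) :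
  ptime e (fun x => code_state (l x)) ->
  ptime e (fun x => tree_of_seq (@code_entry _) (l x).2).
Proof. exact: ptime_snd. Qed.

End Projections.

Lemma code_lit_inj N : injective (@code_lit N).
Proof. by apply: tree_of_pair_inj; [apply: code_var_inj | apply: code_val_inj]. Qed.

Lemma code_entry_inj N : injective (@code_entry N).
Proof.
apply: tree_of_pair_inj; first exact/tree_of_seq_inj/code_lit_inj.
exact/tree_of_option_inj/code_var_inj.
Qed.

Section Algorithm.
Variables (X : Type) (N : X -> naming) (e : X -> tree).

Lemma ptime_lookup (h : forall x, seq (literal (N x))) (v : forall x, variable (N x)) :
  ptime e (fun x => code_clause (h x)) ->
  ptime e (fun x => code_var (v x)) ->
  ptime e (fun x => tree_of_option (@code_val _) (lookup (h x) (v x))).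
Proof.
move=> Hh Hv; apply: ptime_ohead.
apply: (ptime_map (A := fun x => literal (N x)) (cA := fun x => @code_lit (N x))
   (f := fun _ => snd)).
  apply: (ptime_filter (P := fun x y => y.1 == v x)) Hh _.
  apply: ptime_eqop; first by move=> p; apply: code_var_inj.
    apply: ptime_lit1; ptime_arg.
  ptime_arg.
apply: ptime_lit2; ptime_arg.
Qed.

Lemma ptime_values (ds : forall x, seq (variable (N x) * seq (value (N x))))
    (v : forall x, variable (N x)) :
  ptime e (fun x => code_domains (ds x)) ->
  ptime e (fun x => code_var (v x)) ->
  ptime e (fun x => tree_of_seq (@code_val _) (values (ds x) (v x))).
Proof.
move=> Hds Hv; apply: ptime_flatten.
apply: (ptime_map (A := fun x => (variable (N x) * seq (value (N x)))%type)
   (cA := fun x => tree_of_domain (@code_var (N x)) (@code_val (N x)))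
   (f := fun _ => snd)).
  apply: (ptime_filter (P := fun x y => y.1 == v x)) Hds _.
  apply: ptime_eqop; first by move=> p; apply: code_var_inj.
    exact: ptime_fst (ptime_snd (ptime_id _)).
  ptime_arg.
exact: ptime_snd (ptime_snd (ptime_id _)).
Qed.

Lemma ptime_matched (M : forall x, seq (entry (N x))) (v : forall x, variable (N x)) :
  ptime e (fun x => tree_of_seq (@code_entry _) (M x)) ->
  ptime e (fun x => code_var (v x)) ->
  ptime e (fun x => tree_of_seq (@code_clause _) (matched (M x) (v x))).
Proof.
move=> HM Hv.
apply: (ptime_map (A := fun x => entry (N x)) (cA := fun x => @code_entry (N x))
   (f := fun _ => fst)).
  apply: (ptime_filter (P := fun x y => y.2 == Some (v x))) HM _.
  apply: ptime_eqop; first by move=> p; exact/tree_of_option_inj/code_var_inj.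
    apply: ptime_entry2; ptime_arg.
  apply: ptime_some; ptime_arg.
apply: ptime_entry1; ptime_arg.
Qed.

Lemma ptime_remove1 (x : forall x, entry (N x)) (M : forall x, seq (entry (N x))) :
  ptime e (fun i => code_entry (x i)) ->
  ptime e (fun x => tree_of_seq (@code_entry _) (M x)) ->
  ptime e (fun i => tree_of_seq (@code_entry _) (remove1 (x i) (M i))).
Proof.
move=> Hx HM; apply: ptime_cat; last apply: ptime_behead.
  apply: (ptime_filter (P := fun i y => y != x i)) HM _.
  apply: ptime_not; apply: ptime_eqop; first by move=> p; apply: code_entry_inj.
    ptime_arg.
  ptime_arg.
apply: (ptime_filter (P := fun i y => y == x i)) HM _.
apply: ptime_eqop; first by move=> p; apply: code_entry_inj.
  ptime_arg.
ptime_arg.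
Qed.

(** Numbers are not coded, so the comparison runs in unary: [behead] accounts for the predecessor,
    each matched clause removes one more value, and there is room if something is left. *)
Lemma ptime_has_room (ds : forall x, seq (variable (N x) * seq (value (N x))))
    (M : forall x, seq (entry (N x))) (v : forall x, variable (N x)) :
  ptime e (fun x => code_domains (ds x)) ->
  ptime e (fun x => tree_of_seq (@code_entry _) (M x)) ->
  ptime e (fun x => code_var (v x)) ->
  ptime e (fun x => tree_of_bool (has_room (ds x) (M x) (v x))).
Proof.
move=> Hds HM Hv.
have Hd := ptime_behead (ptime_values Hds Hv); have Hm := ptime_matched HM Hv.
apply: (@ptime_eq _ _ (fun x => tree_of_bool (~~ nilp
   (foldl (fun s _ => behead s) (behead (values (ds x) (v x)))
      (matched (M x) (v x)))))).
  move=> x; rewrite /has_room -size_behead; congr tree_of_bool.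
  elim: (matched _ _) (behead _) => [|c m IH] s /=; first by case: s.
  by rewrite IH size_behead ltn_predRL.
apply: ptime_not; apply: ptime_isnil.
apply: (ptime_foldl_additive (cA := fun x => @code_clause (N x))
  (cB := fun x => tree_of_seq (@code_val (N x))) (d := 1)
  (step := fun x s _ => behead s)) => //.
  by move=> x [|a s] c /=; lia.
by apply: ptime_behead; exact: ptime_snd (ptime_snd (ptime_id _)).
Qed.

Lemma ptime_satisfies (h : forall x, seq (literal (N x))) (v : forall x, variable (N x))
    (c : forall x, seq (literal (N x))) :
  ptime e (fun x => code_clause (h x)) ->
  ptime e (fun x => code_var (v x)) ->
  ptime e (fun x => code_clause (c x)) ->
  ptime e (fun x => tree_of_bool (satisfies (h x) (v x) (c x))).
Proof.
move=> Hh Hv Hc; have Hl := ptime_lookup Hh Hv.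
apply: (ptime_has (A := fun x => literal (N x)) (P := fun x (y : literal (N x)) =>
   (y.1 == v x) && (if lookup (h x) (v x) is Some a then a != y.2 else false))) Hc _.
apply: ptime_and.
  apply: ptime_eqop; first by move=> p; apply: code_var_inj.
    apply: ptime_lit1; ptime_arg.
  ptime_arg.
apply: (ptime_option (cA := fun p => @code_val (N (tag p))) (cB := fun _ => tree_of_bool)
  (f := fun _ => false) (g := fun p a => a != (tagged p).2)) => /=.
- ptime_arg.
- exact: ptime_false.
- apply: ptime_not; apply: ptime_eqop; first by move=> p; apply: code_val_inj.
    ptime_arg.
  apply: ptime_lit2; exact: ptime_snd (ptime_fst (ptime_id _)).
Qed.

Lemma ptime_reassign (M : forall x, seq (entry (N x))) (y : forall x, entry (N x))
    (v : forall x, variable (N x)) :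
  ptime e (fun x => tree_of_seq (@code_entry _) (M x)) ->
  ptime e (fun i => code_entry (y i)) ->
  ptime e (fun x => code_var (v x)) ->
  ptime e (fun i => tree_of_seq (@code_entry _) (reassign (M i) (y i) (v i))).
Proof.
move=> HM Hy Hv; apply: ptime_node; last exact: ptime_remove1.
by apply: ptime_node; [exact: ptime_entry1 Hy | apply: ptime_some].
Qed.

Lemma ptime_candidates (M : forall x, seq (entry (N x))) :
  ptime e (fun x => tree_of_seq (@code_entry _) (M x)) ->
  ptime e (fun x => tree_of_seq (@code_find _)
     (candidates (M x))).
Proof.
move=> HM; apply: ptime_flatten.
apply: (ptime_map (A := fun x => entry (N x)) (cA := fun x => @code_entry (N x))
  (f := fun x (y : entry (N x)) => [seq (l.1, y) | l <- y.1])) HM _.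
apply: (ptime_map (A := fun p => literal (N (tag p))) 
  (cA := fun p => @code_lit (N (tag p)))
  (f := fun p (l : literal (N (tag p))) => (l.1, tagged p))).
  apply: ptime_entry1; ptime_arg.
apply: ptime_node; first by apply: ptime_lit1; ptime_arg.
exact: ptime_snd (ptime_fst (ptime_id _)).
Qed.

End Algorithm.

Lemma ptime_waiting X (N : X -> naming) e (h : forall x, seq (literal (N x)))
    (M : forall x, seq (entry (N x))) (v : forall x, variable (N x)) :
  ptime e (fun x => code_clause (h x)) ->
  ptime e (fun x => tree_of_seq (@code_entry _) (M x)) ->
  ptime e (fun x => code_var (v x)) ->
  ptime e (fun x => tree_of_option (@code_entry _) (waiting (h x) (M x) (v x))).
Proof.
move=> Hh HM Hv; apply: ptime_ohead.
apply: (ptime_filter (P := fun x y => (y.2 == None) && satisfies (h x) (v x) y.1)) HM _.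
apply: ptime_and.
  apply: ptime_eqop; first by move=> p; exact/tree_of_option_inj/code_var_inj.
    apply: ptime_entry2; ptime_arg.
  exact: ptime_none.
apply: ptime_satisfies; [ptime_arg | ptime_arg | apply: ptime_entry1; ptime_arg].
Qed.

Lemma ptime_fresh X (N : X -> naming) e
    (ds : forall x, seq (variable (N x) * seq (value (N x))))
    (M : forall x, seq (entry (N x))) (v : forall x, variable (N x))
    (c : forall x, seq (literal (N x))) :
  ptime e (fun x => code_domains (ds x)) ->
  ptime e (fun x => tree_of_seq (@code_entry _) (M x)) ->
  ptime e (fun x => code_var (v x)) ->
  ptime e (fun x => code_clause (c x)) ->
  ptime e (fun x => tree_of_option (@code_val _) (fresh (ds x) (M x) (v x) (c x))).
Proof.
move=> Hds HM Hv Hc; have Hm := ptime_matched HM Hv.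
apply: ptime_ohead; have Hvs := ptime_values Hds Hv.
apply: (ptime_filter
  (P := fun x a => all (fun c' => (v x, a) \notin c') (c x :: matched (M x) (v x)))) Hvs _.
apply: (ptime_all (A := fun p => seq (literal (N (tag p))))
  (cA := fun p => @code_clause (N (tag p)))
  (P := fun p c' => (v (tag p), tagged p) \notin c')).
  by apply: ptime_cons; ptime_arg.
apply: ptime_not; apply: (ptime_mem (A := fun p => literal (N (tag (tag p))))
  (cA := fun p => @code_lit (N (tag (tag p))))).
- by move=> p; apply: code_lit_inj.
- apply: ptime_node; first by ptime_arg.
  exact: ptime_snd (ptime_fst (ptime_id _)).
- ptime_arg.
Qed.

Lemma ptime_adjust X (N : X -> naming) e
    (ds : forall x, seq (variable (N x) * seq (value (N x))))
    (ps : forall x, seq (literal (N x)))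
    (s : forall x, state (N x)) (v : forall x, variable (N x))
    (c : forall x, seq (literal (N x))) :
  ptime e (fun x => code_domains (ds x)) ->
  ptime e (fun x => code_clause (ps x)) ->
  ptime e (fun x => code_state (s x)) ->
  ptime e (fun x => code_var (v x)) ->
  ptime e (fun x => code_clause (c x)) ->
  ptime e (fun x => code_clause (adjust (ds x) (ps x) (s x) (v x) (c x))).
Proof.
move=> Hds Hps Hs Hv Hc.
have Ho := ptime_state1 Hs; have HM := ptime_state2 Hs.
have Hf := ptime_fresh Hds HM Hv Hc.
apply: (ptime_if (cA := fun x => @code_clause (N x))
  (b := fun x => satisfies ((s x).1 ++ ps x) (v x) (c x)) (f := fun x => (s x).1)
  (g := fun x => if fresh (ds x) (s x).2 (v x) (c x) is Some a
                 then (v x, a) :: (s x).1 else (s x).1)) => //.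
  by apply: ptime_satisfies => //; apply: ptime_cat.
apply: (ptime_option (cA := fun x => @code_val (N x)) (cB := fun x => @code_clause (N x))
  (g := fun x a => (v x, a) :: (s x).1)) => //.
apply: (ptime_cons (cA := fun p => @code_lit (N (tag p)))
  (f := fun p => (v (tag p), tagged p)) (l := fun p => (s (tag p)).1)); last by ptime_arg.
by apply: ptime_node; ptime_arg.
Qed.

Lemma ptime_visit X (N : X -> naming) e
    (ds : forall x, seq (variable (N x) * seq (value (N x))))
    (ps : forall x, seq (literal (N x)))
    (st : forall x, (option (variable (N x)) * state (N x))%type)
    (z : forall x, (variable (N x) * entry (N x))%type) :
  ptime e (fun x => code_domains (ds x)) ->
  ptime e (fun x => code_clause (ps x)) ->
  ptime e (fun x => @code_visit (N x) (st x)) ->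
  ptime e (fun x => @code_find (N x) (z x)) ->
  ptime e (fun x => @code_visit (N x)
     (visit (ds x) (ps x) (st x) (z x))).
Proof.
move=> Hds Hps Hst Hz.
have Ht : ptime e (fun x => tree_of_option (@code_var (N x)) (st x).1) by exact: ptime_fst Hst.
have Hs : ptime e (fun x => @code_state (N x) (st x).2) by exact: ptime_snd Hst.
have Ho := ptime_state1 Hs; have HM := ptime_state2 Hs.
have Hv : ptime e (fun x => code_var (z x).1) by exact: ptime_fst Hz.
have Hy : ptime e (fun x => code_entry (z x).2) by exact: ptime_snd Hz.
have Hc := ptime_entry1 Hy; have Hu := ptime_entry2 Hy.
apply: (ptime_if (cA := fun x => @code_visit (N x))
  (b := fun x => (st x).1 == Some (z x).1)
  (f := fun x => if waiting ((st x).2.1 ++ ps x) (st x).2.2 (z x).1 is Some y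
    then (None, ((st x).2.1, reassign (st x).2.2 y (z x).1))
    else ((z x).2.2, (adjust (ds x) (ps x) (st x).2 (z x).1 (z x).2.1,
         reassign (st x).2.2 (z x).2 (z x).1)))) => //.
  apply: (ptime_eqop (cA := fun x => tree_of_option (@code_var (N x)))) Ht _.
    by move=> x; exact/tree_of_option_inj/code_var_inj.
  exact: (ptime_some (cA := fun x => @code_var (N x))).
apply: (ptime_option (cA := fun x => @code_entry (N x))
  (cB := fun x => @code_visit (N x))
  (g := fun x y => (None, ((st x).2.1, reassign (st x).2.2 y (z x).1)))).
- by apply: ptime_waiting => //; apply: ptime_cat.
- apply: ptime_node => //; apply: ptime_node; first exact: ptime_adjust.
  exact: ptime_reassign.
- apply: ptime_node; first exact: ptime_leaf.
  apply: ptime_node; first ptime_arg.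
  by apply: ptime_reassign; ptime_arg.
Qed.

Lemma ptime_discover X (N : X -> naming) e
    (L : forall x, seq (variable (N x) * entry (N x)))
    (z : forall x, (variable (N x) * entry (N x))%type) :
  ptime e (fun x => tree_of_seq (@code_find _) (L x)) ->
  ptime e (fun x => @code_find (N x) (z x)) ->
  ptime e (fun x => tree_of_seq (@code_find _)
    (discover (L x) (z x))).
Proof.
move=> HL Hz.
have Hv : ptime e (fun x => code_var (z x).1) by exact: ptime_fst Hz.
have Hy : ptime e (fun x => code_entry (z x).2) by exact: ptime_snd Hz.
have Hu := ptime_entry2 Hy.
have HL1 : ptime e (fun x => tree_of_seq (@code_var (N x)) [seq y.1 | y <- L x]).
  apply: (ptime_map (A := fun x => (variable (N x) * entry (N x))%type)
     (f := fun x y => y.1)) HL _.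
  exact: ptime_fst (ptime_snd (ptime_id _)).
apply: (ptime_if (cA := fun x => tree_of_seq (@code_find (N x)))
  (b := fun x => (_ \notin _) && (if (z x).2.2 is Some u
     then u \in [seq y.1 | y <- L x] else true)) (f := fun x => z x :: L x)) => //.
  apply: ptime_and.
    apply: ptime_not; apply: (ptime_mem (cA := fun x => @code_var (N x))) => // x.
    exact: code_var_inj.
  apply: (ptime_option (cA := fun x => @code_var (N x)) (cB := fun _ => tree_of_bool)
     (f := fun=> true) (g := fun x u => u \in [seq y.1 | y <- L x])) => //.
    exact: ptime_true.
  apply: (ptime_mem (cA := fun p => @code_var (N (tag p)))); [|ptime_arg | ptime_arg].
  by move=> p; apply: code_var_inj.
exact: ptime_cons.
Qed.

Lemma tree_size_discover N (L : seq (variable N * entry N)) (z : variable N * entry N) :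
  tree_size (tree_of_seq (@code_find N) (discover L z)) <=
  tree_size (tree_of_seq (@code_find N) L) + tree_size (code_find z) + 1.
Proof. by rewrite /discover; case: ifP => _ /=; lia. Qed.

(** The candidates come from the input and not from the accumulator, so a whole pass adds an amount
    independent of the list found so far, and the outer loop is additive like the inner one. *)
Lemma ptime_search X (N : X -> naming) e
    (ds : forall x, seq (variable (N x) * seq (value (N x))))
    (M : forall x, seq (entry (N x))) :
  ptime e (fun x => code_domains (ds x)) ->
  ptime e (fun x => tree_of_seq (@code_entry _) (M x)) ->
  ptime e (fun x => tree_of_seq (@code_find _)
    (search (ds x) (M x))).
Proof.
move=> Hds HM; have HK := ptime_candidates HM; have [d Hd] := ptime_size HK.
pose c x := @code_find (N x).
have grow x s t : tree_size (tree_of_seq (@c x) (discover s t)) <=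
    tree_size (tree_of_seq (@c x) s) + (tree_size (e x) + tree_size (c _ t) + 2) ^ 1.
  by apply: leq_trans (tree_size_discover _ _) _; rewrite expn1 -/(c x); lia.
have [d' Hd'] : polybounded (fun s => (s + 2) ^ d * (s + (s + 2) ^ d + 2) ^ 1).
  by polybound.
apply: (ptime_foldl_additive (d := d')
  (cA := fun x => tree_of_domain (@code_var (N x)) (@code_val (N x)))
  (cB := fun x => tree_of_seq (@c x)) (s0 := fun=> [::])
  (step := fun x L _ => foldl (@discover _ _) L (candidates (M x)))) => //.
- move=> x L t /=.
  apply: leq_trans (foldl_additive_growth _ _ (grow x)) _; rewrite leq_add2l.
  have le : (tree_size (e x) + 2) ^ d' <=
      (tree_size (e x) + tree_size (tree_of_domain (@code_var _) (@code_val _) t) + 2) ^ d'.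
    by apply: leq_exp2rW; lia.
  apply: leq_trans (leq_trans (Hd' (tree_size (e x))) le).
  by apply: leq_mul; [exact: Hd | apply: leq_exp2rW; rewrite leq_add2r leq_add2l; exact: Hd].
- exact: ptime_leaf.
apply: (ptime_foldl_additive (d := 1)
  (cA := fun p => @c (tag p)) (cB := fun p => tree_of_seq (@c (tag p)))
  (step := fun x => @discover _ _)) => //.
- move=> x s t; apply: leq_trans (tree_size_discover _ _) _.
  by rewrite expn1 /c; lia.
- by rewrite /c; ptime_arg.
- by rewrite /c; ptime_arg.
apply: ptime_discover; rewrite /c; ptime_arg.
Qed.

(** * Growth of the state within a phase *)

Lemma tree_size_seqE (A : Type) (c : A -> tree) s :
  tree_size (tree_of_seq c s) = (sumn [seq (tree_size (c x)).+1 | x <- s]).+1.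
Proof. by elim: s => //= a s ->; lia. Qed.

Lemma perm_tree_size (A : eqType) (c : A -> tree) s t :
  perm_eq s t -> tree_size (tree_of_seq c s) = tree_size (tree_of_seq c t).
Proof. by move=> st; rewrite !tree_size_seqE; congr _.+1; apply/perm_sumn/perm_map. Qed.

Lemma tree_size_remove1 (V E : choiceType) (c : seq (V * E) * option V -> tree) x M :
  tree_size (tree_of_seq c (remove1 x M)) <= tree_size (tree_of_seq c M).
Proof.
have [xM|xM] := boolP (x \in M).
  by rewrite -(perm_tree_size c (perm_remove1 xM)) /=; lia.
rewrite /remove1 (_ : [seq y <- M | y == x] = [::]) ?cats0.
  rewrite (_ : [seq y <- M | y != x] = M) //.
  by apply/all_filterP/allP => y yM; apply: contraNneq xM => <-.
by apply/eqP; rewrite -[_ == _]negbK -has_filter has_pred1.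
Qed.

Section Growth.
Variables (N : naming).
Implicit Types (M : seq (entry N)) (y : entry N) (s : state N) (v : variable N).

Lemma tree_size_reassign M y v :
  tree_size (tree_of_seq (@code_entry N) (reassign M y v)) <=
  tree_size (tree_of_seq (@code_entry N) M) + tree_size (code_entry y) +
    tree_size (code_var v) + 10.
Proof. by have := tree_size_remove1 (@code_entry N) y M; rewrite /reassign /=; lia. Qed.

(** An entry of [M] is replaced, so its size is not charged again. This matters for a waiting
    clause, which is found in the state and not in the search list. *)
Lemma tree_size_reassign_mem M y v : y \in M ->
  tree_size (tree_of_seq (@code_entry N) (reassign M y v)) <=
  tree_size (tree_of_seq (@code_entry N) M) + tree_size (code_var v) + 10.
Proof.
by move=> yM; rewrite -(perm_tree_size (@code_entry N) (perm_remove1 yM)) /reassign /=; lia.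
Qed.

Lemma mem_values (ds : seq (variable N * seq (value N))) v a :
  a \in values ds v -> exists2 d, d \in ds & d.1 = v /\ a \in d.2.
Proof.
case/flattenP => t /mapP[d]; rewrite mem_filter => /andP[/eqP dv dd] -> ad.
by exists d.
Qed.

Lemma tree_size_values (ds : seq (variable N * seq (value N))) v a : a \in values ds v ->
  tree_size (code_val a) <= tree_size (code_domains ds).
Proof.
case/mem_values => d dd [_ ad].
have := tree_size_seq_mem (@code_val N) ad.
have := tree_size_seq_mem (tree_of_domain (@code_var N) (@code_val N)) dd.
by rewrite /code_domains /=; lia.
Qed.

Lemma tree_size_adjust (ds : seq (variable N * seq (value N))) ps s v c :
  tree_size (code_clause (adjust ds ps s v c)) <=
  tree_size (code_clause s.1) + tree_size (code_var v) +
    tree_size (code_domains ds) + 10.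
Proof.
rewrite /adjust; case: ifP => _; first by lia.
case Ea: (fresh _ _ _ _) => [a|]; last by lia.
have /andP[_ /tree_size_values] := ohead_filter_mem Ea.
by rewrite /code_clause /=; lia.
Qed.

(** The increment must not involve [st]: the value of a new change is charged to [ds], the
    reassigned entry to [z], and a waiting entry is already counted in the state. *)
Lemma tree_size_visit (ds : seq (variable N * seq (value N))) ps st z :
  tree_size (code_visit (visit ds ps st z)) <= tree_size (code_visit st) +
    10 * tree_size (code_find z) +
    10 * tree_size (code_domains ds) + 30.
Proof.
rewrite /visit; case: ifP => _; last by lia.
case Ey: (waiting _ _ _) => [y|] /=.
  have /andP[_ yM] := ohead_filter_mem Ey.
  have := tree_size_reassign_mem z.1 yM.
  rewrite /code_find /code_visit /code_state /tree_of_pair /=; lia.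
have := tree_size_reassign st.2.2 z.2 z.1; have := tree_size_adjust ds ps st.2 z.1 z.2.1.
have := tree_size_gt0 (tree_of_option (@code_var N) st.1).
case: z {Ey} => v [c1 u] /=.
rewrite /code_find /code_visit /code_state /tree_of_pair /= /code_clause.
have : tree_size (tree_of_option (@code_var N) u) <= tree_size (code_entry (c1, u)).
  by rewrite /=; lia.
lia.
Qed.

End Growth.

Lemma ptime_target X (N : X -> naming) e
    (ds : forall x, seq (variable (N x) * seq (value (N x))))
    (M : forall x, seq (entry (N x))) :
  ptime e (fun x => code_domains (ds x)) ->
  ptime e (fun x => tree_of_seq (@code_entry _) (M x)) ->
  ptime e (fun x => tree_of_option (@code_var _) (target (ds x) (M x))).
Proof.
move=> Hds HM; apply: ptime_ohead.
apply: (ptime_filter (P := fun x v => has_room (ds x) (M x) v)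
  (cA := fun x => @code_var (N x))).
  apply: (ptime_map (A := fun x => (variable (N x) * entry (N x))%type)
     (f := fun x y => y.1)) (ptime_search Hds HM) _.
  exact: ptime_fst (ptime_snd (ptime_id _)).
apply: ptime_has_room; ptime_arg.
Qed.

(** The search list is computed from the state at the start of the phase and stays fixed during the
    walk, so this fold is additive. *)
Lemma ptime_phase X (N : X -> naming) e
    (ds : forall x, seq (variable (N x) * seq (value (N x))))
    (ps : forall x, seq (literal (N x))) (s : forall x, state (N x)) :
  ptime e (fun x => code_domains (ds x)) ->
  ptime e (fun x => code_clause (ps x)) ->
  ptime e (fun x => code_state (s x)) ->
  ptime e (fun x => code_state (phase (ds x) (ps x) (s x))).
Proof.
move=> Hds Hps Hs; have HM := ptime_state2 Hs.
pose c x := @code_visit (N x).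
have [d Hd] := ptime_size Hds.
have [d' Hd'] : polybounded (fun n => 10 * n + 10 * (n + 2) ^ d + 30) by polybound.
suff : ptime e (fun x => c x (foldl (visit (ds x) (ps x)) (target (ds x) (s x).2, s x)
   (search (ds x) (s x).2))) by apply: ptime_snd.
apply: (ptime_foldl_additive (d := d') (cB := c)
  (cA := fun x => @code_find (N x))
  (step := fun x => visit (ds x) (ps x))).
- move=> x st z; apply: leq_trans (tree_size_visit _ _ _ _) _.
  set n := tree_size (e x) + _; have := Hd' n.
  have le : (tree_size (e x) + 2) ^ d <= (tree_size (e x) +
     tree_size (code_find z) + 2) ^ d.
    by apply: leq_exp2rW; lia.
  have := leq_trans (Hd x) le; rewrite -/n.
  have : tree_size (code_find z) <= n by exact: leq_addl.
  rewrite /c; lia.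
- exact: ptime_search.
- by apply: ptime_node => //; apply: ptime_target.
- apply: ptime_visit; rewrite /c; ptime_arg.
Qed.

Lemma ptime_initial X (N : X -> naming) e
    (ds : forall x, seq (variable (N x) * seq (value (N x))))
    (cs : forall x, seq (seq (literal (N x))))
    (ps : forall x, seq (literal (N x))) :
  ptime e (fun x => code_domains (ds x)) ->
  ptime e (fun x => tree_of_seq (@code_clause _) (cs x)) ->
  ptime e (fun x => code_clause (ps x)) ->
  ptime e (fun x => code_state (initial (ds x) (cs x) (ps x))).
Proof.
move=> Hds Hcs Hps; apply: ptime_node; last first.
  apply: (ptime_map (cA := fun x => @code_clause (N x))
    (cB := fun x => @code_entry (N x)) (f := fun x c => (c, None))) => //.
  by apply: ptime_node; [ptime_arg | exact: ptime_leaf].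
pose c x := tree_of_domain (@code_var (N x)) (@code_val (N x)).
apply: (ptime_foldl_additive (d := 1) (cA := c) (cB := fun x => @code_clause (N x))
  (s0 := fun _ => [::]) (step := fun x => extend_total (ps x))) => //.
- move=> x o [v s]; rewrite /extend_total expn1; case: (lookup _ _) => [a|].
    by lia.
  case: s => [|a s] /=; rewrite /code_clause /c /=; lia.
- exact: ptime_leaf.
pose Y := {x : X & ((variable (N x) * seq (value (N x))) * seq (literal (N x)))%type}.
pose e' (p : Y) := Node (e (tag p)) (Node (c _ (tagged p).1) (code_clause (tagged p).2)).
have Ho : ptime e' (fun p => code_clause (tagged p).2) by rewrite /e'; ptime_arg.
have Hd : ptime e' (fun p => c _ (tagged p).1) by rewrite /e'; ptime_arg.
have Hv : ptime e' (fun p => code_var (tagged p).1.1) by exact: ptime_fst Hd.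
have Hs : ptime e' (fun p => tree_of_seq (@code_val _) (tagged p).1.2).
  exact: ptime_snd Hd.
apply: (ptime_option (e := e') (cA := fun p : Y => @code_val (N (tag p)))
  (cB := fun p : Y => @code_clause (N (tag p)))
  (o := fun p : Y => lookup ((tagged p).2 ++ ps (tag p)) (tagged p).1.1)
  (g := fun p _ => (tagged p).2)
  (f := fun p : Y => if ohead (tagged p).1.2 is Some a
    then ((tagged p).1.1, a) :: (tagged p).2 else (tagged p).2)).
- apply: ptime_lookup => //; apply: ptime_cat => //; rewrite /e'; ptime_arg.
- apply: (ptime_option (cA := fun p : Y => @code_val (N (tag p)))
    (cB := fun p : Y => @code_clause (N (tag p)))
    (g := fun p a => ((tagged p).1.1, a) :: (tagged p).2)) => //.
    exact: ptime_ohead.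
  by apply: ptime_node; [apply: ptime_node|]; ptime_arg.
- ptime_arg.
Qed.

(** The entry point has index 0, so [b] is placed there and its auxiliary functions start at index
    1, whence the instance [k = 1]. *)
Lemma ptime_computes (X : Type) (e f : X -> tree) : ptime e f ->
  exists (p : program) (T : {poly nat}), forall x, computes_within p T (e x) (f x).
Proof.
move=> /(_ 1) [q [b [d H]]]; exists (b :: q), (('X + 2%:P) ^+ d)%R => x.
have [n] := H [:: b] [::] x erefl; rewrite cats0 => ev le; exists n => //.
rewrite horner_exp hornerD hornerX hornerC.
suff -> : ((tree_size (e x) + 2%:R) ^+ d)%R = (tree_size (e x) + 2) ^ d by [].
by elim: d {H le} => // d IH; rewrite GRing.exprS IH expnS.
Qed.

(** * One program for all instances *)

Lemma tree_size_seq_le (A : Type) (c : A -> tree) s b :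
  all (fun a => tree_size (c a) <= b) s ->
  tree_size (tree_of_seq c s) <= size s * b.+1 + 1.
Proof. by elim: s => //= a s IH /andP[le /IH]; lia. Qed.

(** All instances, types included, form one index type, so [ptime] yields a program and a bound
    valid for all of them. The validity proofs belong to the record because the states are bounded
    through the invariant, which rests on them. *)
Record problem := Problem {
  names : naming;
  dom_of : variable names -> {fset value names};
  multi_clauses : {mset {fset variable names * value names}}%mset;
  start : {fmap variable names -> value names};
  doms_neq0 : forall v, dom_of v != fset0;
  multi_clausesP : multi_clause_set dom_of multi_clauses;
  startP : partial_assignment dom_of start;
  doms : seq (variable names * seq (value names));
  clauses : seq (seq (literal names));
  start_list : seq (literal names);
  domsP : lists_domains dom_of multi_clauses doms;
  clausesP : lists_clauses multi_clauses clauses;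
  start_listP : lists_assignment start start_list }.

Definition code_problem x := tree_of_input (@code_var (names x)) (@code_val (names x))
  (doms x) (clauses x) (start_list x).

(** With [n] the size of the input: at most [(n + 1) * n] changes of size at most [n], and at most
    [n] entries of size at most [2 * n + 3]; every list cell, each list end and the final pair add
    one. *)
Definition state_bound n :=
  ((n + 1) * n * (n + 1) + 1) + (n * (2 * n + 4) + 1) + 1.

(** Nothing in a good state is foreign to the input: changes use names and values from [doms x],
    entries use clauses from [clauses x], and a match is a variable of its clause because the clause
    is satisfied there. *)
Lemma tree_size_good x o M :
  good (@dom_of x) (multi_clauses x) (start x) (doms x) (clauses x) (start_list x) o M ->
  size o <= (size (clauses x)).+1 * size (doms x) ->
  tree_size (code_state (o, M)) <= state_bound (tree_size (code_problem x)).
Proof.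
move=> g szo; rewrite /state_bound; set n := tree_size (code_problem x).
have nE : n = (tree_size (code_domains (doms x)) +
   (tree_size (tree_of_seq (@code_clause (names x)) (clauses x)) +
    tree_size (code_clause (start_list x))).+1).+1 by [].
have le_ds : size (doms x) <= n.
  have : size (doms x) <= tree_size (code_domains (doms x)) by apply: size_tree_size.
  lia.
have le_cs : size (clauses x) <= n.
  have : size (clauses x) <= tree_size (tree_of_seq (@code_clause (names x)) (clauses x)).
    exact: size_tree_size.
  lia.
have le_ct : tree_size (tree_of_seq (@code_clause (names x)) (clauses x)) <= n by lia.
have o_le : tree_size (code_clause o) <= size o * n.+1 + 1.
  apply: tree_size_seq_le; apply/allP => l lo.
  have [] := good_changes g lo; rewrite -(mem_domains (domsP x)) => /mapP[d dd ld] lD.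
  have l2 : l.2 \in d.2.
    by have [_ /(_ d dd)/perm_mem->] := domsP x; rewrite -ld.
  have := tree_size_seq_mem (@code_val (names x)) l2.
  have := tree_size_seq_mem (tree_of_domain (@code_var (names x)) (@code_val (names x))) dd.
  move: nE; rewrite /code_domains /code_lit /tree_of_literal /= ld; lia.
have M_le : tree_size (tree_of_seq (@code_entry (names x)) M) <= size M * (2 * n + 3).+1 + 1.
  apply: tree_size_seq_le; apply/allP => y yM.
  have y1 : tree_size (code_clause y.1) <= n.
    apply: leq_trans (tree_size_seq_mem (@code_clause (names x)) (good_entry g yM)) _.
    exact: le_ct.
  suff h : tree_size (tree_of_option (@code_var (names x)) y.2) <= n + 2.
    by apply: (@leq_trans (n + (n + 2)).+1); [exact: (leq_add y1 h) | lia].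
  case Ey: y.2 => [v|] /=; last by lia.
  have /(satisfiesP (start_listP x))[l ly [lv _]] := good_matched g yM Ey.
  have := tree_size_seq_mem (@code_lit (names x)) ly.
  move: y1; rewrite /code_clause /= lv; lia.
have szM : size M = size (clauses x) by rewrite -(perm_size (good_entries g)) size_map.
have h1 : size o * n.+1 <= (n + 1) * n * (n + 1).
  by rewrite addn1; apply: leq_mul => //; apply: leq_trans szo _; apply: leq_mul.
have h2 : size M * (2 * n + 3).+1 <= n * (2 * n + 4).
  by rewrite szM; apply: leq_mul => //; lia.
change (tree_size (code_state (o, M))) with (tree_size (code_clause o) +
  tree_size (tree_of_seq (@code_entry (names x)) M)).+1.
lia.
Qed.

(** The growth bound of a phase involves the state it starts from, so the additive criterion does
    not apply; the general [ptime_foldl] is used, with the invariant supplying [state_bound] on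
    every prefix. *)
Lemma ptime_changes : ptime code_problem
  (fun x => code_clause (changes (doms x) (clauses x) (start_list x))).
Proof.
have Hds : ptime code_problem (fun x => code_domains (doms x)).
  exact: ptime_fst (ptime_id _).
have Hcs : ptime code_problem (fun x => tree_of_seq (@code_clause (names x)) (clauses x)).
  exact: ptime_fst (ptime_snd (ptime_id _)).
have Hps : ptime code_problem (fun x => code_clause (start_list x)).
  exact: ptime_snd (ptime_snd (ptime_id _)).
apply: ptime_rev; apply: ptime_state1.
apply: (ptime_foldl (B := state_bound) (cT := fun x => @code_clause (names x))
  (cS := fun x => @code_state (names x))
  (step := fun x s _ => phase (doms x) (start_list x) s)) => //.
- by rewrite /state_bound; polybound.
- move=> x k lek.
  have [g sz _] := run_prefix (@doms_neq0 x) (@multi_clausesP x) (domsP x)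
    (clausesP x) (start_listP x) (@startP x) lek.
  rewrite [foldl _ _ _]surjective_pairing; apply: tree_size_good g _.
  by apply: leq_trans sz _; rewrite leq_mul2r ltnS lek orbT.
- exact: ptime_initial.
- apply: ptime_phase; ptime_arg.
Qed.

Theorem theorem1p8p4 :
  exists (p : program) (T : {poly nat}),
  forall (V E : choiceType) (cV : V -> tree) (cE : E -> tree)
         (D : V -> {fset E}) (F : {mset {fset V * E}}%mset)
         (phi0 : {fmap V -> E}),
    injective cV -> injective cE ->
    (forall v, D v != fset0) ->
    multi_clause_set D F ->
    partial_assignment D phi0 ->
  forall (ds : seq (V * seq E)) (cs : seq (seq (V * E))) (ps : seq (V * E)),
    lists_domains D F ds -> lists_clauses F cs -> lists_assignment phi0 ps ->
  exists s : seq (V * E),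
    [/\ computes_within p T (tree_of_input cV cE ds cs ps)
          (tree_of_output cV cE s),
        conservative_seq D F phi0 s &
        matching_maximum D F (foldl change phi0 s)].
Proof.
have [p [T HT]] := ptime_computes ptime_changes; exists p, T.
move=> V E cV cE D F phi0 cV_inj cE_inj D0 DF Dphi ds cs ps Hds Hcs Hps.
exists (changes ds cs ps).
have [g t0] := run_good D0 DF Hds Hcs Hps Dphi.
split.
- exact: (HT (@Problem (Naming cV_inj cE_inj) D F phi0 D0 DF Dphi ds cs ps Hds Hcs Hps)).
- exact: good_conservative g.
- by have := good_maximum DF Hds Hcs Hps g t0.
Qed.
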